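(* Let $\psi\in L^2(\mathbb{R})$ and assume that $\mathbf{T}^l\big(\frac{\partial^k}{\partial t^k}\psi\big)\in L^2(\mathbb{R})$ for all $l,k\in\{0,1,2\}$. Let $s\in L^2(\mathbb{R})$ and $(x_0,y_0)\in\mathbb{R}\times\mathbb{R}^+$. If $W_\psi s(x_0,y_0)=0$ and the Jacobian determinant $J_{x_0,y_0}:=\det(D(W_\psi s))(x_0,y_0)$ of $W_\psi s$ at $(x_0,y_0)$ is nonzero, then, for $\varepsilon>0$ converging to $0$, $$\operatorname{sgn}(J_{x_0,y_0})\lim_{\varepsilon\to0}\frac{\partial}{\partial x}\phi_\psi^s(x_0,y_0+\varepsilon)=-\infty,\qquad \operatorname{sgn}(J_{x_0,y_0})\lim_{\varepsilon\to0}\frac{\partial}{\partial x}\phi_\psi^s(x_0,y_0-\varepsilon)=\infty,$$ and $$\operatorname{sgn}(J_{x_0,y_0})\lim_{\varepsilon\to0}\frac{\partial}{\partial y}\phi_\psi^s(x_0+\varepsilon,y_0)=\infty,\qquad \operatorname{sgn}(J_{x_0,y_0})\lim_{\varepsilon\to0}\frac{\partial}{\partial y}\phi_\psi^s(x_0-\varepsilon,y_0)=-\infty.$$ If moreover $\mathbf{T}^l\big(\frac{\partial^k}{\partial t^k}\psi\big)\in L^2(\mathbb{R})$ for all $l,k\in\{0,1,2,3\}$, then the limits $$\lim_{\varepsilon\to0}\frac{\partial}{\partial x}\phi_\psi^s(x_0+\varepsilon,y_0)=\lim_{\varepsilon\to0}\frac{\partial}{\partial x}\phi_\psi^s(x_0-\varepsilon,y_0)$$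 and $$\lim_{\varepsilon\to0}\frac{\partial}{\partial y}\phi_\psi^s(x_0,y_0+\varepsilon)=\lim_{\varepsilon\to0}\frac{\partial}{\partial y}\phi_\psi^s(x_0,y_0-\varepsilon)$$ exist, are finite, and are equal as indicated.
   Context: $\mathbb{R}^+=(0,\infty)$. For $s,\psi\in L^2(\mathbb{R})$ the continuous wavelet transform is $$W_\psi s(x,y)=\frac{1}{\sqrt{y}}\int_{\mathbb{R}}s(t)\,\overline{\psi\!\left(\frac{t-x}{y}\right)}\,dt,\qquad x\in\mathbb{R},\ y\in\mathbb{R}^+.$$ The operator $\mathbf{T}$ is time-weighting, $(\mathbf{T}f)(t)=tf(t)$, and $\mathbf{T}^l$ is multiplication by $t^l$. The phase is $\phi_\psi^s=\arg(W_\psi s)$; for the purpose of derivatives it is any locally defined continuous branch of the argument near a point where $W_\psi s\neq0$. $D(W_\psi s)$ is the real $2\times2$ Jacobian matrix of the map $(x,y)\mapsto(\operatorname{Re}W_\psi s(x,y),\operatorname{Im}W_\psi s(x,y))$, so that with $u=\operatorname{Re}W_\psi s$ and $v=\operatorname{Im}W_\psi s$ one has $J_{x_0,y_0}=(u_xv_y-u_yv_x)(x_0,y_0)$. *)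

(* Defs.v *)
From HB Require Import structures.
From mathcomp Require Import all_boot all_order all_algebra.
From mathcomp Require Import all_classical all_reals all_analysis.
From mathcomp Require Import complex.

Set Implicit Arguments.
Unset Strict Implicit.
Unset Printing Implicit Defensive.

Import Order.TTheory GRing.Theory Num.Theory numFieldNormedType.Exports.

Local Open Scope classical_set_scope.
Local Open Scope ring_scope.
Local Open Scope complex_scope.

Section Defs.
Context {R : realType}.
Local Notation mu := (@lebesgue_measure R).

Definition csquare_integrable (f : R -> R[i]) : Prop :=
  [/\ measurable_fun setT (fun t => complex.Re (f t)),
      measurable_fun setT (fun t => complex.Im (f t)) &
      (\int[mu]_t ((Normc.normc (f t)) ^+ 2)%:E < +oo)%E].

Definition clocally_integrable (f : R -> R[i]) : Prop :=
  locally_integrable setT (fun t => complex.Re (f t)) /\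
  locally_integrable setT (fun t => complex.Im (f t)).

Definition cintegral (f : R -> R[i]) : R[i] :=
  (\int[mu]_t complex.Re (f t)) +i* (\int[mu]_t complex.Im (f t)).

Definition test_function (phi : R -> R) : Prop :=
  (forall n t, derivable (derive1n n phi) t 1) /\
  compact (closure [set t | phi t != 0]).

(* Real-valued test functions suffice for complex-valued [f] and [g], since both
   sides are linear in [phi].  For [k = 0] the condition says that [g] and [f]
   agree almost everywhere. *)
Definition weak_derivative (k : nat) (f g : R -> R[i]) : Prop :=
  [/\ clocally_integrable f, clocally_integrable g &
      forall phi, test_function phi ->
        cintegral (fun t => f t * (derive1n k phi t)%:C) =
        (-1) ^+ k * cintegral (fun t => g t * (phi t)%:C)].

Definition time_weight (l : nat) (f : R -> R[i]) : R -> R[i] :=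
  fun t => (t ^+ l)%:C * f t.

(* [T^l (psi^(k))] is in L^2 for all [l, k <= N], derivatives being taken in the
   sense of distributions (hence unique up to null sets). *)
Definition weighted_derivatives_L2 (N : nat) (psi : R -> R[i]) : Prop :=
  forall k, (k <= N)%N -> exists2 g, weak_derivative k psi g &
    forall l, (l <= N)%N -> csquare_integrable (time_weight l g).

(* Meaningful for [0 < p.2] only. *)
Definition wavelet (psi s : R -> R[i]) (p : R * R) : R[i] :=
  ((Num.sqrt p.2)^-1)%:C *
  cintegral (fun t => s t * conjc (psi ((t - p.1) / p.2))).

(* Rows: real and imaginary part; columns: derivatives in x and in y. *)
Definition jacobian_mx (W : R * R -> R[i]) (p : R * R) : 'M[R]_2 :=
  \matrix_(i < 2, j < 2)
    let part z := if i == 0 then complex.Re z else complex.Im z in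
    if j == 0 then derive1 (fun x => part (W (x, p.2))) p.1
    else derive1 (fun y => part (W (p.1, y))) p.2.

Definition jacobian_det (W : R * R -> R[i]) (p : R * R) : R :=
  \det (jacobian_mx W p).

(* [theta] is only constrained near [p]; its values elsewhere are irrelevant. *)
Definition phase_branch (W : R * R -> R[i]) (p : R * R) (theta : R * R -> R) :=
  \forall q \near p, {for q, continuous theta} /\
    W q = (Normc.normc (W q))%:C * (cos (theta q) +i* sin (theta q)).

(* The value [d] is determined by [W] and [p]: a branch is required to
   exist, and the derivative must be [d] for every branch. *)
Definition phase_dx (W : R * R -> R[i]) (p : R * R) (d : R) : Prop :=
  [/\ W p != 0, exists theta, phase_branch W p theta &
      forall theta, phase_branch W p theta ->
        is_derive p.1 (1 : R) (fun x => theta (x, p.2)) d].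

Definition phase_dy (W : R * R -> R[i]) (p : R * R) (d : R) : Prop :=
  [/\ W p != 0, exists theta, phase_branch W p theta &
      forall theta, phase_branch W p theta ->
        is_derive p.2 (1 : R) (fun y => theta (p.1, y)) d].

(* The limit, as [e] decreases to 0, of the partial derivative [D] of the phase
   at [gamma e] is [L]; in particular it is defined for all small [e > 0]. *)
Definition phase_lim (D : R * R -> R -> Prop) (gamma : R -> R * R)
    (L : \bar R) : Prop :=
  exists2 d : R -> R, (\forall e \near 0^'+, D (gamma e) (d e)) &
    (d e)%:E @[e --> 0^'+] --> L.

End Defs.

(* Main.v *)
Require Import Defs.
From HB Require Import structures.
From mathcomp Require Import all_boot all_order all_algebra.
From mathcomp Require Import all_classical all_reals all_analysis.
From mathcomp Require Import complex.
From mathcomp Require Import measurable_realfun ring lra.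

Set Implicit Arguments.
Unset Strict Implicit.
Unset Printing Implicit Defensive.

Import Order.TTheory GRing.Theory Num.Theory numFieldNormedType.Exports.

Local Open Scope classical_set_scope.
Local Open Scope ring_scope.

(** Write W = u + iv for the wavelet transform. Any branch of the phase has
    derivative (u v' - v u') / (u ^ 2 + v ^ 2) in a direction in which u and v
    have derivatives u' and v' ([phase_derivative]). Let p be a zero of W with
    nonzero Jacobian J.
    - On the line through p perpendicular to the direction of differentiation,
      u and v vanish linearly, so the denominator is quadratic and the
      numerator linear; the slope of the numerator is J up to sign. The phase
      derivative thus has a simple pole with residue of the sign of J or of
      - J, and takes opposite infinite limits on the two sides
      ([rotation_rate_pole], [pole_blowup]).
    - On the line through p parallel to that direction, the linear terms of the
      numerator cancel, and a second order expansion gives the limit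
      (u' v'' - v' u'') / (2 (u' ^ 2 + v' ^ 2)), evaluated at p, from both sides
      ([rotation_rate_inflection]).

    It remains to see that W has partial derivatives that are continuous in the
    transverse variable when N = 2, and continuous second derivatives along
    horizontal and vertical lines when N = 3, where N bounds the l and k for
    which T ^ l psi ^ (k) is in L2 ([wavelet_smooth]). All the regularity is carried by psi, none by s.
    - A locally integrable function with an integrable weak derivative agrees
      almost everywhere with a primitive of it ([weak_deriv_primitive]): test
      against smoothed indicators of an interval whose end points are Lebesgue
      points. Iterating, psi has a representative P of class C ^ (N - 1).
    - Averaging over unit intervals turns the weighted L2 bounds into the
      uniform bounds (1 + |t|) ^ N * |P ^ (k) t| <= C for k < N ([decay]).
    - Replacing psi by P does not change W ([ae_affine]). The integrand
      s t * P ((t - x) / y) and its derivatives are dominated, for (x, y) in a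
      neighbourhood of a given point, by K * |s t| / (1 + |t|), which is
      integrable as a product of two L2 functions. One may therefore
      differentiate under the integral sign: - y * d/dx replaces the wavelet P
      by P', and d/dy replaces it, up to powers of y, by P and by t * P'. Each
      derivative in y thus costs one power of t, and this is what the exponents
      l provide. *)

(** * Smooth step functions *)
Section Smooth.
Context {R : realType}.
Implicit Types (f g : R -> R) (n : nat).

(** Derivatives are peeled off from the inside, so that closure under sums,
    products and inverses follows by induction on the order. *)
Fixpoint derivable_upto n f : Prop :=
  if n is m.+1 then (forall x, derivable f x 1) /\ derivable_upto m (derive1 f)
  else True.

Definition smooth f := forall n, derivable_upto n f.

Lemma smooth_derivable f x : smooth f -> derivable f x 1.
Proof. by move=> /(_ 1%N)[]. Qed.

Lemma smooth_derive1 f : smooth f -> smooth (derive1 f).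
Proof. by move=> sf n; have [] := sf n.+1. Qed.

Lemma smooth_derive1n f n : smooth f -> smooth (derive1n n f).
Proof.
elim: n => [//|n IHn] sf; rewrite derive1nS; apply: smooth_derive1; exact: IHn.
Qed.

Lemma derivable_uptoW n f : derivable_upto n.+1 f -> derivable_upto n f.
Proof. by elim: n f => [//|n IHn] f [df dn]; split=> //; exact: IHn. Qed.

Lemma derivable_upto_cst n (c : R) : derivable_upto n (cst c).
Proof.
elim: n c => [//|n IHn] c; split; first by move=> x; exact: derivable_cst.
have -> : derive1 (cst c) = cst (0:R); last exact: IHn.
by apply/funext => x; rewrite derive1_cst.
Qed.

Lemma derivable_uptoD n f g :
  derivable_upto n f -> derivable_upto n g -> derivable_upto n (f + g).
Proof.
elim: n f g => [//|n IHn] f g [df dnf] [dg dng]; split.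
  by move=> x; exact: derivableD.
have -> : derive1 (f + g) = derive1 f + derive1 g; last exact: IHn.
by apply/funext => x;
  rewrite derive1E (deriveD (df x) (dg x)) -(derive1E f) -(derive1E g).
Qed.

Lemma derivable_uptoM n f g :
  derivable_upto n f -> derivable_upto n g -> derivable_upto n (f * g).
Proof.
elim: n f g => [//|n IHn] f g fn gn.
have [[df dnf] [dg dng]] := (fn, gn); split.
  by move=> x; exact: derivableM.
have -> : derive1 (f * g) = f * derive1 g + g * derive1 f.
  by apply/funext => x;
    rewrite derive1E (deriveM (df x) (dg x)) -(derive1E f) -(derive1E g).
by apply: derivable_uptoD; apply: IHn => //; exact: derivable_uptoW.
Qed.

Lemma derivable_uptoV n f : (forall x, f x != 0) ->
  derivable_upto n f -> derivable_upto n (fun x => (f x)^-1).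
Proof.
move=> f0; elim: n => [//|n IHn] fn; have [df dnf] := fn; split.
  by move=> x; exact: derivableV.
have -> : derive1 (fun x => (f x)^-1) =
    cst (-1) * ((fun x => (f x)^-1) * (fun x => (f x)^-1) * (derive1 f)).
  apply/funext => x; rewrite derive1E deriveV// -derive1E !fctE.
  by rewrite /GRing.scale/= expr2 invfM mulN1r mulNr.
have fVn := IHn (derivable_uptoW fn).
apply: derivable_uptoM; first exact: derivable_upto_cst.
by apply: derivable_uptoM => //; exact: derivable_uptoM.
Qed.

Lemma is_derive_affine f (a b x df : R) : is_derive (a * x + b) 1 f df ->
  is_derive x 1 (fun t => f (a * t + b)) (a * df).
Proof.
move=> fx; have ax : is_derive x 1 (fun t => a * t + b) a.
  by apply: is_derive_eq; rewrite addr0 /GRing.scale/= mulr1.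
have := @is_derive1_comp R f (fun t => a * t + b) x df a fx ax.
by rewrite mulrC.
Qed.

Lemma derivable_upto_affine n f (a b : R) :
  derivable_upto n f -> derivable_upto n (fun t => f (a * t + b)).
Proof.
elim: n f => [//|n IHn] f [df dnf].
have D (x : R) : is_derive x 1 (fun t : R => f (a * t + b)) (a * (derive1 f) (a * x + b)).
  by apply: is_derive_affine; rewrite derive1E; apply: derivableP.
split; first by move=> x; have [] := D x.
have -> : derive1 (fun t => f (a * t + b)) = cst a * (fun t => (derive1 f) (a * t + b)).
  by apply/funext => x; rewrite derive1E; have [_ ->] := D x.
by apply: derivable_uptoM; [exact: derivable_upto_cst|exact: IHn].
Qed.

(** The family t ^ - n * exp (- 1 / t), extended by 0, is used rather than
    exp (- 1 / t) alone because its span is stable under differentiation. *)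
Definition flat n (t : R) := if 0 < t then t ^- n * expR (- t^-1) else 0.

(** One term of the exponential series, (1 / t) ^ (n + 2) / (n + 2)!, already
    beats t ^ - n. *)
Lemma flat_bound n t : `|flat n t| <= n.+2`!%:R * t ^+ 2.
Proof.
rewrite /flat; case: ifPn => [t0|_]; last first.
  by rewrite normr0 mulr_ge0// sqr_ge0.
have tV0 : 0 < t^-1 by rewrite invr_gt0.
rewrite ger0_norm; last by rewrite mulr_ge0 ?expR_ge0// invr_ge0 exprn_ge0// ltW.
rewrite expRN ler_pdivrMr ?expR_gt0//.
have := expR_ge1Dxn n.+1 (ltW tV0) => h.
have {}h : t^-1 ^+ n.+2 / n.+2`!%:R <= expR t^-1.
  by apply: le_trans h; rewrite lerDr.
have fp : (0 : R) < n.+2`!%:R by rewrite ltr0n fact_gt0.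
rewrite -mulrA; apply: (@le_trans _ _ (n.+2`!%:R * (t ^+ 2 * (t^-1 ^+ n.+2 / n.+2`!%:R)))).
  rewrite le_eqVlt; apply/orP; left; apply/eqP.
  rewrite -addn2 exprD -exprVn; field.
  by rewrite ?expf_neq0 ?gt_eqF//= addn2 gt_eqF.
by rewrite ler_pM2l// ler_pM2l// exprn_gt0.
Qed.

Lemma is_derive_quadratic_bound f (C : R) :
  (forall t, `|f t| <= C * t ^+ 2) -> is_derive (0 : R) 1 f 0.
Proof.
move=> fC; have f0 : f 0 = 0.
  by apply/normr0_eq0/eqP; rewrite eq_le normr_ge0 andbT (le_trans (fC 0))// expr0n mulr0.
apply/is_derive1_caratheodory; exists (fun z => f z / z); split.
- move=> z; rewrite f0 !subr0; have [->|z0] := eqVneq z 0; first by rewrite f0 mulr0.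
  by rewrite divfK.
- rewrite /prop_for /continuous_at /= f0 mul0r; apply/cvgr0Pnorm_le => e e0.
  have C1 : 0 < `|C| + 1 by rewrite ltr_wpDl.
  near=> z; have [->|z0] := eqVneq z 0; first by rewrite f0 mul0r normr0 ltW.
  rewrite normrM normfV ler_pdivrMr ?normr_gt0//.
  apply: (le_trans (fC z)); rewrite -real_normK ?num_real// expr2 mulrA ler_wpM2r//.
  apply: (@le_trans _ _ ((`|C| + 1) * `|z|)).
    by rewrite ler_wpM2r// (le_trans (ler_norm _))// lerDl.
  rewrite -ler_pdivlMl//; near: z; apply: cvgr0_norm_le; last first.
    by rewrite mulr_gt0// invr_gt0.
  exact: cvg_id.
- by rewrite f0 mul0r.
Unshelve. all: by end_near. Qed.

(** Away from 0 this is the product rule; at 0 both sides vanish, by the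
    quadratic bound. *)
Lemma is_derive_flat n (t : R) :
  is_derive t 1 (flat n) (flat n.+2 t - n%:R * flat n.+1 t).
Proof.
have [t0|t0|->] := ltgtP t 0.
- have -> : flat n.+2 t - n%:R * flat n.+1 t = 0.
    by rewrite /flat ltNge (ltW t0)/= mulr0 subr0.
  apply: (@near_eq_is_derive _ _ _ (cst (0:R))).
  near=> z; rewrite /flat ltNge ltW//=; near: z; exact: lt_nbhsl.
- have tn0 : t != 0 by rewrite gt_eqF.
  have dV : is_derive t 1 (fun t : R => t^-1) (- t^-2).
    have h := is_deriveV tn0 (is_derive_id t 1); apply: (is_derive_eq h).
    by rewrite /GRing.scale/= mulr1.
  have dE : is_derive t 1 (fun t : R => expR (- t^-1)) (expR (- t^-1) * t^-2).
    apply: (@is_derive1_comp R expR (fun t => - t^-1)).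
    by apply: is_derive_eq; rewrite opprK.
  have dX : is_derive t 1 (fun t : R => t ^- n) (- n%:R * t ^- n.+1).
    have := @is_deriveX _ _ (fun t : R => t^-1) n t 1 _ dV.
    rewrite (_ : _ ^+ n = (fun t => t ^- n)); last first.
      apply/funext => z; rewrite -exprVn; elim: (n) => //= m.
      by rewrite !exprS => <-.
    move=> h; apply: (is_derive_eq h).
    case: (n) => [|m]; first by rewrite /GRing.scale/=; ring.
    by rewrite /GRing.scale/= /= -!exprVn !exprS; ring.
  have dM : is_derive t 1 (fun t : R => t ^- n * expR (- t^-1))
      (flat n.+2 t - n%:R * flat n.+1 t).
    have h := is_deriveM dX dE; apply: (is_derive_eq h).
    by rewrite /GRing.scale/= /flat t0 -!exprVn !exprS; ring.
  apply: near_eq_is_derive dM; near=> z; rewrite /flat ifT//.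
  near: z; exact: lt_nbhsr.
- have -> : flat n.+2 0 - n%:R * flat n.+1 0 = 0.
    by rewrite /flat ltxx mulr0 subr0.
  exact: is_derive_quadratic_bound (flat_bound n).
Unshelve. all: by end_near. Qed.


Lemma derivable_upto_flat m n : derivable_upto m (flat n).
Proof.
elim: m n => [//|m IHm] n.
split; first by move=> x; have [] := is_derive_flat n x.
have -> : derive1 (flat n) = flat n.+2 + cst (- n%:R) * flat n.+1.
  apply/funext => x; rewrite derive1E; have [_ ->] := is_derive_flat n x.
  by rewrite !fctE mulNr.
apply: derivable_uptoD => //; apply: derivable_uptoM => //.
exact: derivable_upto_cst.
Qed.

Lemma smooth_cst (c : R) : smooth (cst c).
Proof. by move=> n; exact: derivable_upto_cst. Qed.

Lemma smoothD f g : smooth f -> smooth g -> smooth (f + g).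
Proof. by move=> sf sg n; exact: derivable_uptoD. Qed.

Lemma smoothM f g : smooth f -> smooth g -> smooth (f * g).
Proof. by move=> sf sg n; exact: derivable_uptoM. Qed.

Lemma smooth_affine f (a b : R) : smooth f -> smooth (fun t => f (a * t + b)).
Proof. by move=> sf n; exact: derivable_upto_affine. Qed.

(** The denominator never vanishes, since t > 0 or 1 - t > 0. *)
Definition step (t : R) := flat 0 t / (flat 0 t + flat 0 (- 1 * t + 1)).

Let flat_ge0 (t : R) : 0 <= flat 0 t.
Proof. by rewrite /flat; case: ifP => // _; rewrite expr0 invr1 mul1r expR_ge0. Qed.

Let flat_gt0 (t : R) : 0 < t -> 0 < flat 0 t.
Proof. by rewrite /flat => ->; rewrite expr0 invr1 mul1r expR_gt0. Qed.

Let step_den_gt0 (t : R) : 0 < flat 0 t + flat 0 (- 1 * t + 1).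
Proof.
have [t0|t0] := ltP 0 t; first by rewrite ltr_pwDl ?flat_gt0.
by rewrite ltr_wpDl ?flat_gt0//; lra.
Qed.

Lemma smooth_step : smooth step.
Proof.
have sf n : smooth (flat n) by move=> m; exact: derivable_upto_flat.
rewrite (_ : step = flat 0 * (fun t => (flat 0 t + flat 0 (- 1 * t + 1))^-1))//.
apply: smoothM => // m; apply: derivable_uptoV.
  by move=> t; rewrite gt_eqF.
by apply: derivable_uptoD; [exact: sf|exact: smooth_affine].
Qed.

Lemma step_eq0 (t : R) : t <= 0 -> step t = 0.
Proof. by move=> t0; rewrite /step {1}/flat ltNge t0 mul0r. Qed.

Lemma step_eq1 (t : R) : 1 <= t -> step t = 1.
Proof.
move=> t1; rewrite /step.
have -> : flat 0 (- 1 * t + 1) = 0 by rewrite /flat ifF//; apply/negbTE; rewrite -leNgt;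
  lra.
by rewrite addr0 divff// gt_eqF// flat_gt0//; lra.
Qed.

Lemma step_ge0_le1 (t : R) : 0 <= step t <= 1.
Proof.
rewrite /step divr_ge0 ?flat_ge0//=; last exact/ltW/step_den_gt0.
by rewrite ler_pdivrMr// mul1r lerDl.
Qed.

Lemma derive1_step_eq0 (t : R) : t < 0 \/ 1 < t -> derive1 step t = 0.
Proof.
rewrite derive1E => -[t0|t1].
  rewrite -(near_eq_derive (f := cst (0 : R))) ?derive_cst//.
  by near=> z; rewrite step_eq0// ltW//; near: z; exact: lt_nbhsl.
rewrite -(near_eq_derive (f := cst (1 : R))) ?derive_cst//.
by near=> z; rewrite step_eq1// ltW//; near: z; exact: lt_nbhsr.
Unshelve. all: by end_near. Qed.

Lemma continuous_smooth f : smooth f -> continuous f.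
Proof.
move=> sf t; apply/differentiable_continuous/derivable1_diffP.
exact: smooth_derivable.
Qed.

Lemma derive1_step_bounded : exists2 M : R, 0 < M & forall t, `|derive1 step t| <= M.
Proof.
have c01 : {within `[0, 1 : R], continuous (fun t => `|derive1 step t|)}.
  apply: continuous_subspaceT => t.
  apply: (continuous_comp (f := derive1 step) (g := fun y => `|y|)).
    exact/continuous_smooth/smooth_derive1/smooth_step.
  exact: norm_continuous.
have [c _ hc] := EVT_max ler01 c01.
exists (`|derive1 step c| + 1) => [|t]; first by rewrite ltr_wpDl.
have [t0|t0] := ltP t 0; first by rewrite derive1_step_eq0 ?normr0 ?addr_ge0//; left.
have [t1|t1] := ltP 1 t; first by rewrite derive1_step_eq0 ?normr0 ?addr_ge0//; right.
by rewrite (le_trans (hc t _)) ?lerDl// in_itv/= t0 t1.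
Qed.

End Smooth.
(** * Test functions *)
Section Mollify.
Context {R : realType}.
Local Notation mu := (@lebesgue_measure R).
Implicit Types (f g h phi : R -> R).

Lemma Rintegrable_le (D : set R) f g : measurable D -> measurable_fun D f ->
  (forall t, D t -> `|f t| <= g t) ->
  mu.-integrable D (EFin \o g) -> mu.-integrable D (EFin \o f).
Proof.
move=> mD mf fg; apply: le_integrable => //; first exact/measurable_EFinP.
by move=> t Dt /=; rewrite lee_fin (le_trans (fg t Dt))// ler_norm.
Qed.

Lemma RintegrableZl (D : set R) f (k : R) : measurable D ->
  mu.-integrable D (EFin \o f) -> mu.-integrable D (EFin \o (fun t => k * f t)).
Proof.
move=> mD intf.
rewrite (_ : EFin \o _ = fun t => (k%:E * (EFin \o f) t)%E) //.
exact: integrableZl.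
Qed.

Lemma RintegrableD (D : set R) f g : measurable D ->
  mu.-integrable D (EFin \o f) -> mu.-integrable D (EFin \o g) ->
  mu.-integrable D (EFin \o (fun t => f t + g t)).
Proof.
move=> mD intf intg.
rewrite (_ : EFin \o _ = (EFin \o f) \+ (EFin \o g))%E//.
exact: integrableD.
Qed.

Lemma Rintegral_dominated_cvg (D : set R) (f_ : nat -> R -> R) f g :
  measurable D -> (forall n, measurable_fun D (f_ n)) ->
  (forall t, D t -> f_ n t @[n --> \oo] --> f t) ->
  mu.-integrable D (EFin \o g) -> (forall n t, D t -> `|f_ n t| <= g t) ->
  \int[mu]_(t in D) f_ n t @[n --> \oo] --> \int[mu]_(t in D) f t.
Proof.
move=> mD mf ff ig fg; apply: fine_cvg.
have mEf n : measurable_fun D (fun t => (f_ n t)%:E) by exact/measurable_EFinP.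
have cf t : D t -> (f_ n t)%:E @[n --> \oo] --> (f t)%:E.
  by move=> Dt; apply: cvg_EFin; [exact: nearW|exact: ff].
have mf' : measurable_fun D (fun t => (f t)%:E).
  exact: emeasurable_fun_cvg mEf cf.
have fg' n t : D t -> (`|(f_ n t)%:E| <= (EFin \o g) t)%E.
  by move=> Dt; rewrite lee_fin fg.
have intf : mu.-integrable D (EFin \o f).
  apply: (Rintegrable_le mD _ _ ig); first exact/measurable_EFinP.
  move=> t Dt; have nt : `|f_ n t| @[n --> \oo] --> `|f t| by apply: cvg_norm; exact: ff.
  rewrite -(cvg_lim (@Rhausdorff R) nt); apply: limr_le.
    by apply/cvg_ex; exists `|f t|; exact: nt.
  by near=> n; exact: fg.
rewrite /Rintegral fineK; last exact: integrable_fin_num.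
exact: (@dominated_cvg _ _ _ mu D mD (fun n t => (f_ n t)%:E) _ (EFin \o g)).
Unshelve. all: by end_near.
Qed.

Lemma ae_lebesgue_exists (P : R -> Prop) : {ae mu, forall t, P t} -> exists t, P t.
Proof.
move=> [N [mN N0 subN]]; apply: contrapT => /forallNP nP.
have NT : N = setT by rewrite -subTset => t _; apply: subN => /=; exact: nP.
move: N0; rewrite NT => mu0.
have : (mu `[0%R, 1%R] <= mu setT)%E by rewrite le_measure// inE.
by rewrite mu0 lebesgue_measure_itv/= lte_fin ltr01 oppr0 adde0 lee_fin ler10.
Qed.

Lemma locally_integrable_segment f (a b : R) : locally_integrable setT f ->
  mu.-integrable `[a, b] (EFin \o f).
Proof.
move=> [mf _ cf]; apply/integrableP; split.
  by apply/measurable_EFinP; exact: measurable_funTS.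
by apply: cf => //; exact: segment_compact.
Qed.

(** The integrands against test functions are of this form: f is integrable on
    compact sets and h is a bounded cutoff. *)
Lemma integrable_cutoff f h (a b M : R) : locally_integrable setT f ->
  measurable_fun setT h -> (forall t, `|h t| <= M) ->
  (forall t, t < a \/ b < t -> h t = 0) ->
  mu.-integrable setT (EFin \o (f \* h)).
Proof.
move=> lf mh hM h0; have [mf _ _] := lf.
have -> : f \* h = (f \* h) \_ `[a, b].
  apply/funext => t; rewrite patchE; case: ifPn => //.
  rewrite notin_setE /= in_itv/= => /negP; rewrite negb_and -!ltNge => /orP th.
  by rewrite h0 ?mulr0.
have mab : measurable (`[a, b]%classic : set R) by [].
rewrite -restrict_EFin;
  have /= [+ _] := integrable_mkcond (mu := mu) (EFin \o (f \* h)) mab; apply.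
apply: (@Rintegrable_le _ _ (fun t => M * `|f t|)) => //.
- by apply: measurable_funTS; exact: measurable_funM.
- by move=> t _ /=; rewrite normrM mulrC ler_wpM2r.
- apply: RintegrableZl => //.
  by have /integrable_norm := locally_integrable_segment a b lf.
Qed.

Definition step_at (k a t : R) := step (k * t + - (k * a)).

Lemma smooth_step_at (k a : R) : smooth (step_at k a).
Proof. exact/smooth_affine/smooth_step. Qed.

Lemma step_at_eq0 (k a t : R) : 0 < k -> t <= a -> step_at k a t = 0.
Proof. by move=> k0 ta; rewrite /step_at step_eq0// subr_le0 ler_pM2l. Qed.

Lemma step_at_eq1 (k a t : R) : 0 < k -> a + k^-1 <= t -> step_at k a t = 1.
Proof.
move=> k0 ta; rewrite /step_at step_eq1// -mulrBr -ler_pdivrMl// mulr1.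
by rewrite lerBrDl.
Qed.

Lemma derive1_step_at (k a t : R) :
  derive1 (step_at k a) t = k * derive1 step (k * t + - (k * a)).
Proof.
rewrite derive1E; apply: derive_val; apply: is_derive_affine.
by rewrite derive1E; apply: derivableP; exact/smooth_derivable/smooth_step.
Qed.

Lemma derive1_step_at_eq0 (k a t : R) : 0 < k -> t < a \/ a + k^-1 < t ->
  derive1 (step_at k a) t = 0.
Proof.
move=> k0 ta; rewrite derive1_step_at derive1_step_eq0 ?mulr0//.
case: ta => [ta|ta]; [left|right]; first by rewrite subr_lt0 ltr_pM2l.
by rewrite -mulrBr -ltr_pdivrMl// mulr1 ltrBrDl.
Qed.

Lemma compact_support phi (a b : R) : (forall t, t < a \/ b < t -> phi t = 0) ->
  compact (closure [set t | phi t != 0]).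
Proof.
move=> phi0; apply: (@subclosed_compact _ _ `[a, b]).
- exact: closed_closure.
- exact: segment_compact.
- rewrite [X in _ `<=` X](closure_id `[a, b]).1; last exact: itv_closed.
  apply: closureS => t /=; rewrite in_itv/= => pt.
  rewrite -[_ && _]negbK negb_and -!ltNge; apply/negP => /orP th.
  by move: pt; rewrite phi0 ?eqxx.
Qed.

Lemma test_function_smooth phi (a b : R) : smooth phi ->
  (forall t, t < a \/ b < t -> phi t = 0) -> test_function phi.
Proof.
move=> sphi phi0; split; last exact: compact_support phi0.
by move=> n t; exact/smooth_derivable/smooth_derive1n.
Qed.

(** An approximation of the Dirac mass at a, as k grows. It is supported in the
    interval from a to a + 1 / k, and has integral 1. *)
Definition bump (k a : R) := derive1 (step_at k a).

Lemma test_function_bump (k a : R) : 0 < k -> test_function (bump k a).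
Proof.
move=> k0; apply: (@test_function_smooth _ a (a + k^-1)).
  exact/smooth_derive1/smooth_step_at.
by move=> t; exact: derive1_step_at_eq0.
Qed.

Lemma continuous_bump (k a : R) : continuous (bump k a).
Proof. exact/continuous_smooth/smooth_derive1/smooth_step_at. Qed.

(** An approximation of the indicator of the interval from a to b; its
    derivative is the difference of two bumps. *)
Definition plateau (k a b t : R) := step_at k a t - step_at k b t.

Lemma smooth_plateau (k a b : R) : smooth (plateau k a b).
Proof.
rewrite (_ : plateau k a b = step_at k a + cst (- 1) * step_at k b).
  apply: smoothD; first exact: smooth_step_at.
  by apply: smoothM; [exact: smooth_cst|exact: smooth_step_at].
by apply/funext => t; rewrite /plateau !fctE mulN1r.
Qed.

Lemma plateau_eq0 (k a b t : R) : 0 < k -> a <= b -> t < a \/ b + k^-1 < t ->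
  plateau k a b t = 0.
Proof.
move=> k0 ab [ta|tb]; rewrite /plateau.
  by rewrite !step_at_eq0 ?subrr//; lra.
by rewrite !step_at_eq1 ?subrr//; lra.
Qed.

Lemma test_function_plateau (k a b : R) : 0 < k -> a <= b ->
  test_function (plateau k a b).
Proof.
move=> k0 ab; apply: (@test_function_smooth _ a (b + k^-1)).
  exact: smooth_plateau.
by move=> t; exact: plateau_eq0.
Qed.

Lemma derive1_plateau (k a b t : R) :
  derive1 (plateau k a b) t = bump k a t - bump k b t.
Proof.
rewrite /bump derive1E /plateau.
have d c : derivable (step_at k c) t 1 by exact/smooth_derivable/smooth_step_at.
by rewrite (deriveB (d a) (d b)) -!derive1E.
Qed.

Lemma normr_plateau_le1 (k a b t : R) : `|plateau k a b t| <= 1.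
Proof.
rewrite /plateau ler_norml /step_at.
have /andP[? ?] := step_ge0_le1 (k * t + - (k * a)).
have /andP[? ?] := step_ge0_le1 (k * t + - (k * b)).
by apply/andP; split; lra.
Qed.

Lemma plateau_cvg (a b t : R) : a <= b ->
  plateau n.+1%:R a b t @[n --> \oo] --> (\1_(`]a, b]) t : R).
Proof.
move=> ab; have n0 n : 0 < n.+1%:R :> R by rewrite ltr0n.
have near_inv (c : R) : c < t -> \forall n \near \oo, c + (n.+1%:R)^-1 <= t.
  move=> ct; have tc : 0 < t - c by rewrite subr_gt0.
  apply: filterS (near_infty_natSinv_lt (PosNum tc)) => n /= h.
  by rewrite -lerBrDl ltW.
apply: cvg_near_cst.
have [ta|ta] := leP t a.
  apply: nearW => n; rewrite /plateau !step_at_eq0 ?subrr ?(le_trans ta)//.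
  by rewrite indicE memNset//= in_itv/= ltNge ta.
have [tb|tb] := leP t b.
  near=> n; rewrite /plateau (step_at_eq0 _ tb)// subr0 step_at_eq1//.
    by rewrite indicE mem_set//= in_itv/= ta tb.
  by near: n; exact: near_inv.
near=> n; rewrite /plateau !step_at_eq1//.
- by rewrite subrr indicE memNset//= in_itv/= (leNgt t) tb andbF.
- by near: n; exact: near_inv.
- by near: n; exact: near_inv.
Unshelve. all: by end_near. Qed.

End Mollify.
(** * Weak derivatives and primitives *)
Section DuBoisReymond.
Context {R : realType}.
Local Notation mu := (@lebesgue_measure R).
Implicit Types (f g h phi : R -> R).

Lemma locally_integrable_continuous f : continuous f -> locally_integrable setT f.
Proof.
move=> cf; split; [exact: continuous_measurable_fun|exact: openT|move=> K _ cK].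
have /integrableP[_ +] : mu.-integrable K (EFin \o f).
  by apply: continuous_compact_integrable => //; exact: continuous_subspaceT.
by [].
Qed.

Lemma Rintegral_bump (k a : R) : 0 < k -> \int[mu]_t bump k a t = 1.
Proof.
move=> k0; have kV0 : 0 < k^-1 by rewrite invr_gt0.
have aE : a < a + k^-1 by rewrite ltrDl.
have -> : \int[mu]_t bump k a t = \int[mu]_(t in `[a, a + k^-1]) bump k a t.
  rewrite [RHS]Rintegral_mkcond; apply: eq_Rintegral => t _.
  rewrite patchE; case: ifPn => //; rewrite notin_setE /= in_itv/=.
  move=> /negP; rewrite negb_and -!ltNge => /orP ta.
  by rewrite /bump derive1_step_at_eq0.
have cs : continuous (step_at k a) by exact/continuous_smooth/smooth_step_at.
rewrite /Rintegral (@continuous_FTC2 _ (bump k a) (step_at k a))//=.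
- by rewrite step_at_eq1// (@step_at_eq0 _ k a a)// subr0.
- by apply: continuous_subspaceT; exact: continuous_bump.
- split => [t _||].
  + exact/smooth_derivable/smooth_step_at.
  + by apply: cvg_at_right_filter; exact: cs.
  + by apply: cvg_at_left_filter; exact: cs.
Qed.

Lemma integrable_mul_bump f (k a : R) : 0 < k -> locally_integrable setT f ->
  mu.-integrable setT (EFin \o (f \* bump k a)).
Proof.
move=> k0 lf; have [M M0 hM] := derive1_step_bounded (R := R).
apply: (@integrable_cutoff _ _ _ a (a + k^-1) (k * M)) => //.
- apply: continuous_measurable_fun; exact: continuous_bump.
- by move=> t; rewrite /bump derive1_step_at normrM gtr0_norm// ler_pM2l.
- by move=> t; exact: derive1_step_at_eq0.
Qed.

(** As the bump has integral 1 and height at most k M, the error is at most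
    k M times the integral of |f - f a| over the ball of radius 2 / k, that is
    4 M times its average. The radius 2 / k makes the ball contain the support of
    the bump. *)
Lemma mollify_near f (a : R) : locally_integrable setT f -> exists2 C : R, 0 < C &
  forall k, 0 < k ->
  (`|\int[mu]_t (f t * bump k a t) - f a|%:E <= C%:E * davg f a (2 / k))%E.
Proof.
move=> lf; have [M M0 hM] := derive1_step_bounded (R := R).
exists (4 * M) => [|k k0]; first by rewrite mulr_gt0.
have mf : measurable_fun setT f by case: lf.
have lc : locally_integrable setT (cst (f a)).
  by apply: locally_integrable_continuous => t; exact: cvg_cst.
have lfc : locally_integrable setT (f \- cst (f a)) by exact: locally_integrableB.
have -> : \int[mu]_t (f t * bump k a t) - f a =
    \int[mu]_t ((f t - f a) * bump k a t).
  rewrite -[X in _ - X]mulr1 -(Rintegral_bump a k0).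
  rewrite -RintegralZl//; last first.
    have := integrable_mul_bump (f := cst 1) a k0.
    rewrite (_ : cst 1 \* bump k a = bump k a); last by apply/funext => t;
      rewrite /= mul1r.
    by apply; apply: locally_integrable_continuous => t; exact: cvg_cst.
  rewrite -RintegralB//; [|exact: integrable_mul_bump|exact: integrable_mul_bump].
  by apply: eq_Rintegral => t _; rewrite mulrBl.
have ifc := integrable_mul_bump a k0 lfc.
rewrite EFin_normr_Rintegral//.
apply: (le_trans (le_abse_integral _ _ (measurable_int _ ifc))) => //.
have r0 : 0 < 2 / k by rewrite divr_gt0.
have -> : (\int[mu]_x `|((f x - f a) * bump k a x)%R%:E| =
    \int[mu]_(x in ball a (2 / k)%R) `|((f x - f a) * bump k a x)%R%:E|)%E.
  rewrite [RHS]integral_mkcond; apply: eq_integral => t _.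
  rewrite patchE; case: ifPn => //; rewrite notin_setE ball_itv /= in_itv/=.
  move=> /negP; rewrite negb_and -!leNgt => ta.
  have kV0 : 0 < k^-1 by rewrite invr_gt0.
  by rewrite /bump derive1_step_at_eq0 ?mulr0 ?normr0//; case/orP: ta => ?; lra.
rewrite /davg /iavg lebesgue_measure_ball ?(ltW r0)//.
have -> : ((4 * M)%:E * (((2 / k) *+ 2)%:E^-1 *
    \int[mu]_(y in ball a (2 / k)%R) `|((center (f a) \o f) y)%:E|) =
    (k * M)%:E * \int[mu]_(y in ball a (2 / k)%R) `|((center (f a) \o f) y)%:E|)%E.
  rewrite inver mulrn_eq0/= gt_eqF// muleA -EFinM; congr (_%:E * _)%E.
  by field; rewrite gt_eqF.
have mfa : measurable_fun setT (fun t => f t - f a) by exact: measurable_funB.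
have mb : measurable (ball a (2 / k)) by exact: measurable_ball.
have mabs (h : R -> R) : measurable_fun setT h ->
    measurable_fun (ball a (2 / k)) (fun t => `|(h t)%:E|%E).
  move=> mh; apply: measurableT_comp => //; apply/measurable_EFinP.
  exact: measurable_funTS.
rewrite -ge0_integralZl//; last 2 first.
- exact: (mabs _ mfa).
- by rewrite lee_fin mulr_ge0// ltW.
apply: ge0_le_integral => //.
- apply: (mabs (fun t => (f t - f a) * bump k a t)); apply: measurable_funM => //.
  by apply: continuous_measurable_fun; exact: continuous_bump.
- by apply: measurable_funeM; exact: (mabs _ mfa).
- move=> t _ /=; rewrite lee_fin normrM mulrC /bump derive1_step_at normrM (gtr0_norm k0).
  by rewrite ler_wpM2r// ler_pM2l.
Qed.

Lemma mollify_cvg f (a : R) : locally_integrable setT f -> lebesgue_pt f a ->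
  \int[mu]_t (f t * bump n.+1%:R a t) @[n --> \oo] --> f a.
Proof.
move=> lf fa; have [C C0 hC] := mollify_near a lf.
apply/cvgrPdist_le => e e0.
have /fine_cvgP[fin_d /cvgr0Pnorm_le cv_d] : davg f a r @[r --> 0^'+] --> (0:R)%:E by exact: fa.
have eC : 0 < e / C by rewrite divr_gt0.
have {cv_d} cv_d := cv_d _ eC.
have nd : \forall r \near 0^'+, (davg f a r <= (e / C)%:E)%E.
  near=> r; rewrite -[davg f a r]fineK; last by near: r.
  rewrite lee_fin (le_trans (ler_norm _))//; near: r; exact: cv_d.
move: nd; rewrite near_withinE => -[d /= d0 hd].
have d2 : 0 < d / 2 by rewrite divr_gt0.
near=> n.
have n0 : 0 < n.+1%:R :> R by rewrite ltr0n.
rewrite distrC -lee_fin (le_trans (hC _ n0))//.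
have eE : e = C * (e / C) by rewrite mulrC divfK// gt_eqF.
rewrite [in leRHS]eE EFinM lee_wpmul2l ?lee_fin ?(ltW C0)//.
have k0 : 0 < 2 / n.+1%:R :> R by rewrite divr_gt0.
apply: hd => //=; rewrite sub0r normrN gtr0_norm//.
rewrite -ltr_pdivlMl// mulrC; near: n.
exact: (near_infty_natSinv_lt (PosNum d2)).
Unshelve. all: by end_near. Qed.
Definition weak_deriv f g := forall phi, test_function phi ->
  \int[mu]_t (f t * derive1 phi t) = - \int[mu]_t (g t * phi t).

(** Test the weak derivative on plateaus: one side converges because a and b are
    Lebesgue points of f, the other by dominated convergence. *)
Lemma weak_deriv_increment f g (a b : R) : locally_integrable setT f ->
  mu.-integrable setT (EFin \o g) -> weak_deriv f g ->
  lebesgue_pt f a -> lebesgue_pt f b -> a <= b ->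
  f b - f a = \int[mu]_(t in `]a, b]) g t.
Proof.
move=> lf ig fg fa fb ab.
have n0 n : 0 < n.+1%:R :> R by rewrite ltr0n.
have lim1 : \int[mu]_t (f t * derive1 (plateau n.+1%:R a b) t) @[n --> \oo] -->
    f a - f b.
  under eq_cvg => n.
    under eq_Rintegral do rewrite derive1_plateau mulrBr.
    rewrite (RintegralB _ (integrable_mul_bump a (n0 n) lf) (integrable_mul_bump b (n0 n) lf))//.
    over.
  by apply: cvgB; exact: mollify_cvg.
have lim2 : \int[mu]_t (g t * plateau n.+1%:R a b t) @[n --> \oo] -->
    \int[mu]_t (g t * \1_(`]a, b]) t).
  apply: (@Rintegral_dominated_cvg _ _ _ _ (fun t => `|g t|)) => //.
  - move=> n; apply: measurable_funM; first by have /integrableP[/measurable_EFinP] := ig.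
    apply: continuous_measurable_fun; apply: continuous_smooth.
    exact: smooth_plateau.
  - by move=> t _; apply: cvgM; [exact: cvg_cst|exact: plateau_cvg].
  - by have /integrable_norm := ig.
  - by move=> n t _; rewrite normrM ler_piMr// normr_plateau_le1.
have -> : \int[mu]_(t in `]a, b]) g t = \int[mu]_t (g t * \1_(`]a, b]) t).
  by rewrite Rintegral_mkcond; apply: eq_Rintegral => t _; rewrite patchE indicE;
    case: ifPn => _; rewrite ?mulr1 ?mulr0.
rewrite -opprB; apply/eqP; rewrite eqr_oppLR; apply/eqP.
apply: (cvg_unique _ lim1) => //.
rewrite /=; under eq_cvg do rewrite (fg _ (test_function_plateau (n0 _) ab)).
exact: cvgN.
Qed.

Definition primitive (c : R) g (t : R) := c + \int[mu]_(u in `]-oo, t]) g u.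

Lemma primitiveB (c : R) g (a b : R) : mu.-integrable setT (EFin \o g) -> a <= b ->
  primitive c g b - primitive c g a = \int[mu]_(u in `]a, b]) g u.
Proof.
move=> ig ab; rewrite /primitive opprD addrACA subrr add0r.
by rewrite Rintegral_itvB ?bnd_simp//; exact: integrableS ig.
Qed.

(** Almost every point is a Lebesgue point of f, so one of them can serve as base
    point for the increments. *)
Lemma weak_deriv_primitive f g : locally_integrable setT f ->
  mu.-integrable setT (EFin \o g) -> weak_deriv f g ->
  exists c, {ae mu, forall t, f t = primitive c g t}.
Proof.
move=> lf ig fg; have aef := lebesgue_differentiation lf.
have [a fa] := ae_lebesgue_exists aef.
exists (f a - \int[mu]_(u in `]-oo, a]) g u).
apply: filterS aef; first exact: (ae_filter_ringOfSetsType mu).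
move=> t ft; have /= := primitiveB 0 ig.
rewrite /primitive => pB; have [ta|/ltW at_] := leP t a.
  have := weak_deriv_increment lf ig fg ft fa ta; rewrite -pB//; lra.
by have := weak_deriv_increment lf ig fg fa ft at_; rewrite -pB//; lra.
Qed.

Lemma weak_unique f g : locally_integrable setT f -> locally_integrable setT g ->
  (forall phi, test_function phi ->
    \int[mu]_t (f t * phi t) = \int[mu]_t (g t * phi t)) ->
  {ae mu, forall t, f t = g t}.
Proof.
move=> lf lg fg.
have aef := lebesgue_differentiation lf; have aeg := lebesgue_differentiation lg.
apply: filterS2 aef aeg; first exact: (ae_filter_ringOfSetsType mu).
move=> t ft gt.
apply: (cvg_unique _ (mollify_cvg lf ft)) => //.
rewrite /=; under eq_cvg do rewrite (fg _ (test_function_bump _ (ltr0Sn _ _))).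
exact: mollify_cvg.
Qed.

Lemma continuous_primitive (c : R) g : mu.-integrable setT (EFin \o g) ->
  continuous (primitive c g).
Proof.
move=> ig x; have x1 : x - 1 < x + 1 by lra.
have ig1 : mu.-integrable `[x - 1, x + 1] (EFin \o g) by exact: integrableS ig.
have ci := parameterized_integral_continuous (ltW x1) ig1.
have {}ci : {for x, continuous (fun y => primitive c g (x - 1) +
    parameterized_integral mu (x - 1) y g)}.
  apply: (@continuousD _ R^o); first exact: cvg_cst.
  apply: (within_continuous_continuous x1 ci); rewrite in_itv/=; lra.
have E y : x - 1 <= y -> primitive c g y =
    primitive c g (x - 1) + parameterized_integral mu (x - 1) y g.
  move=> xy; apply/eqP; rewrite -subr_eq0 opprD addrA primitiveB// subr_eq0.
  by rewrite Rintegral_itv_obnd_cbnd//; exact: integrableS ig.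
have xx : x - 1 <= x by lra.
move: ci; rewrite /prop_for /continuous_at (E x xx) => ci.
apply: cvg_trans ci; apply: near_eq_cvg; near=> y; rewrite -E//.
apply: ltW; near: y; apply: lt_nbhsr; lra.
Unshelve. all: by end_near. Qed.

Lemma is_derive_primitive (c : R) g (x : R) : mu.-integrable setT (EFin \o g) ->
  {for x, continuous g} -> is_derive x 1 (primitive c g) (g x).
Proof.
move=> ig cg; have x1 : x < x + 1 by rewrite ltrDl.
have igx : mu.-integrable `]-oo, (x + 1)] (EFin \o g) by exact: integrableS ig.
have [dF F'] := continuous_FTC1 x1 igx (ltNyr _) cg.
have H : is_derive x 1 (fun y => \int[mu]_(u in `]-oo, y]) g u) (g x).
  by split; [exact: dF|rewrite -derive1E; exact: F'].
by have h := is_deriveD (is_derive_cst c x 1) H; apply: (is_derive_eq h); rewrite add0r.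
Qed.

End DuBoisReymond.
(** * Uniform decay from weighted square integrability *)
Section Decay.
Context {R : realType}.
Local Notation mu := (@lebesgue_measure R).
Implicit Types (f g h F : R -> R).

Lemma integrable_oneDsqrV :
  mu.-integrable setT (EFin \o (fun t : R => (1 + t ^+ 2)^-1)).
Proof.
have p0 (t : R) : 0 <= (1 + t ^+ 2)^-1 by rewrite invr_ge0 addr_ge0 ?sqr_ge0.
apply/integrableP; split.
  apply/measurable_EFinP; apply: continuous_measurable_fun.
  exact: continuous_oneDsqrV.
under eq_integral do rewrite /= ger0_norm ?p0//.
have := @ge0_symfun_integralT R (fun t => (1 + t ^+ 2)^-1) p0.
have -> : [set x : R | 0 <= x] = `[0, +oo[%classic.
  by apply/seteqP; split=> x /=; rewrite in_itv/= andbT.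
rewrite [in X in (_ -> _ -> _ = X)%E](@integral0y_oneDsqr R) => ->.
- by rewrite -EFinM ltry.
- exact: continuous_oneDsqrV.
- by move=> t /=; rewrite sqrrN.
Qed.

Definition square_integrable f :=
  measurable_fun setT f /\ mu.-integrable setT (EFin \o (fun t => f t ^+ 2)).

Lemma integrable_prod_L2 f g : square_integrable f -> square_integrable g ->
  mu.-integrable setT (EFin \o (fun t => f t * g t)).
Proof.
move=> [mf f2] [mg g2].
apply: (@Rintegrable_le _ _ _ (fun t => f t ^+ 2 + g t ^+ 2)) => //.
- exact: measurable_funM.
- move=> t _; rewrite normrM -[f t ^+ 2]real_normK ?num_real//.
  rewrite -[g t ^+ 2]real_normK ?num_real//.
  move: `|f t| `|g t| (normr_ge0 (f t)) (normr_ge0 (g t)) => a b a0 b0; nra.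
- exact: RintegrableD.
Qed.

Definition weighted_L2 (N : nat) f := measurable_fun setT f /\
  forall l, (l <= N)%N -> mu.-integrable setT (EFin \o (fun t => (t ^+ l * f t) ^+ 2)).

(** If |f| exceeds 1 / (1 + t ^ 2) then |f| <= (1 + t ^ 2) * f ^ 2. *)
Lemma weighted_L2_integrable N f : (0 < N)%N -> weighted_L2 N f ->
  mu.-integrable setT (EFin \o f).
Proof.
move=> N0 [mf wf]; have f0 := wf 0%N (leq0n _); have f1 := wf 1%N N0.
apply: (@Rintegrable_le _ _ _ (fun t => (1 + t ^+ 2)^-1 +
  ((t ^+ 0 * f t) ^+ 2 + (t ^+ 1 * f t) ^+ 2))) => //.
- move=> t _; have -> : (t ^+ 0 * f t) ^+ 2 + (t ^+ 1 * f t) ^+ 2 = (1 + t ^+ 2) * f t ^+ 2.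
    by rewrite expr0 expr1; ring.
  have p0 : 0 < 1 + t ^+ 2 by rewrite ltr_pwDl// sqr_ge0.
  rewrite -[f t ^+ 2]real_normK ?num_real//.
  have [h|h] := leP `|f t| (1 + t ^+ 2)^-1.
    by rewrite (le_trans h)// lerDl mulr_ge0// ltW.
  rewrite ler_wpDl ?invr_ge0 ?(ltW p0)// [`|f t| ^+ 2]expr2 mulrCA ler_peMr//.
  by rewrite -ler_pdivrMl// mulr1 ltW.
- by apply: RintegrableD => //; [exact: integrable_oneDsqrV|exact: RintegrableD].
Qed.

Definition weight (N : nat) (t : R) := (1 + `|t|) ^+ N.

Lemma weight_gt0 N t : 0 < weight N t.
Proof. by rewrite exprn_gt0// ltr_pwDl. Qed.

Lemma measurable_weight N : measurable_fun setT (weight N).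
Proof. by apply: measurable_funX; apply: measurable_funD => //;
  exact: measurableT_comp. Qed.

Lemma weight_near N (b t : R) : `|t - b| <= 1 -> weight N b <= 2 ^+ N * weight N t.
Proof.
move=> tb; rewrite -exprMn lerXn2r ?nnegrE ?mulr_ge0 ?addr_ge0//.
have : `|b| <= `|t| + `|t - b|.
  by rewrite -[X in `|X| <= _](subKr t) (le_trans (ler_normB _ _))//.
have := normr_ge0 t; lra.
Qed.

Lemma weighted_L2_weight N f : weighted_L2 N f ->
  square_integrable (fun t => weight N t * f t).
Proof.
move=> [mf wf]; have mwf : measurable_fun setT (fun t => weight N t * f t).
  by apply: measurable_funM => //; exact: measurable_weight.
split=> //.
have f0 := wf 0%N (leq0n _); have fN := wf N (leqnn _).
apply: (@Rintegrable_le _ _ _ (fun t => 2 ^+ (N * 2) *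
  ((t ^+ 0 * f t) ^+ 2 + (t ^+ N * f t) ^+ 2))) => //.
- exact: measurable_funX.
- move=> t _; rewrite ger0_norm ?sqr_ge0//.
  have -> : (t ^+ 0 * f t) ^+ 2 + (t ^+ N * f t) ^+ 2 = (1 + (t ^+ N) ^+ 2) * f t ^+ 2.
    by rewrite expr0; ring.
  rewrite exprMn mulrA ler_wpM2r ?sqr_ge0// /weight -!exprM.
  have [t1|t1] := leP `|t| 1.
    apply: (@le_trans _ _ (2 ^+ (N * 2))).
      by rewrite lerXn2r ?nnegrE ?addr_ge0//; have := normr_ge0 t; lra.
    by rewrite ler_peMr ?exprn_ge0// lerDl exprM sqr_ge0.
  apply: (@le_trans _ _ (2 ^+ (N * 2) * `|t| ^+ (N * 2))).
    rewrite -exprMn lerXn2r ?nnegrE ?mulr_ge0 ?addr_ge0//; lra.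
  rewrite ler_pM2l ?exprn_gt0// -normrX ger0_norm; last by rewrite exprM sqr_ge0.
  by rewrite lerDr.
- by apply: RintegrableZl => //; exact: RintegrableD.
Qed.

Lemma le_Rintegral_subset (D : set R) f : measurable D -> (forall t, 0 <= f t) ->
  mu.-integrable setT (EFin \o f) -> \int[mu]_(t in D) f t <= \int[mu]_t f t.
Proof.
move=> mD f0 itf; rewrite /Rintegral fine_le//.
- by apply: integrable_fin_num => //; exact: integrableS itf.
- exact: integrable_fin_num.
- apply: ge0_subset_integral => //; first by case/integrableP : itf.
  by move=> t _; rewrite lee_fin.
Qed.

(** For t between b and b + 1, |F b| is at most |F t| plus the integral of |g|
    over that interval. Averaging over t bounds F b by unit-interval averages of
    |F| and |g|. The weight varies by a factor at most 2 ^ N on the interval, and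
    |x| <= 1 + x ^ 2 bounds the averages by L2 norms. *)
Lemma decay N F g : weighted_L2 N F -> weighted_L2 N g ->
  mu.-integrable setT (EFin \o g) ->
  (forall a b, a <= b -> F b - F a = \int[mu]_(t in `]a, b]) g t) ->
  exists C : R, forall t, weight N t * `|F t| <= C.
Proof.
move=> wF wg ig Fg.
have [mp ip] := weighted_L2_weight wF; have [mq iq] := weighted_L2_weight wg.
set p := fun t => weight N t * F t in mp ip *.
set q := fun t => weight N t * g t in mq iq *.
have le1sq (x : R) : `|x| <= 1 + x ^+ 2.
  rewrite -[x ^+ 2]real_normK ?num_real//.
  move: `|x| (normr_ge0 x) => y y0; nra.
set A := \int[mu]_t p t ^+ 2; set B := \int[mu]_t q t ^+ 2.
exists (2 ^+ N * (1 + A) + 2 ^+ N * (1 + B)) => b.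
(* The unit interval has measure 1, so an average over it is an integral. *)
pose I : set R := `]b, b + 1]%classic.
have mI : measurable I by exact: measurable_itv.
have muI : mu I = 1%:E.
  by rewrite lebesgue_measure_itv/= lte_fin ltrDl ltr01 -EFinD addrAC subrr add0r.
have c1 (c : R) : mu.-integrable I (EFin \o (fun=> c)).
  have lc : locally_integrable setT (cst c).
    by apply: locally_integrable_continuous => t; exact: cvg_cst.
  apply: integrableS (locally_integrable_segment b (b + 1) lc) => //.
  exact: subset_itv_oc_cc.
have I1 (c : R) : \int[mu]_(t in I) c = c.
  by rewrite Rintegral_cst// (_ : fine _ = 1) ?mulr1//; exact: (congr1 fine muI).
have key (f : R -> R) : measurable_fun setT f ->
    mu.-integrable setT (EFin \o (fun t => f t ^+ 2)) ->
    mu.-integrable I (EFin \o (fun t => 1 + f t ^+ 2)) /\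
    \int[mu]_(t in I) (1 + f t ^+ 2) <= 1 + \int[mu]_t f t ^+ 2.
  move=> mf if2; have if2I : mu.-integrable I (EFin \o (fun t => f t ^+ 2)).
    exact: integrableS if2.
  split; first exact: (RintegrableD mI (c1 1) if2I).
  rewrite (RintegralD (mu := mu) mI (c1 1) if2I); apply: lerD; first by rewrite [leLHS]I1.
  by apply: le_Rintegral_subset => // t; rewrite sqr_ge0.
have [ip1 hA] := key _ mp ip; have [iq1 hB] := key _ mq iq.
have step1 t : I t -> weight N b * `|F b| <= 2 ^+ N * (1 + p t ^+ 2) + 2 ^+ N * (1 + B).
  rewrite /I /= in_itv/= => /andP[bt tb].
  have wb u : b < u <= b + 1 -> weight N b <= 2 ^+ N * weight N u.
    by move=> /andP[bu ub]; apply: weight_near; rewrite ler_norml; apply/andP; split; lra.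
  have -> : F b = F t - \int[mu]_(u in `]b, t]) g u by rewrite -(Fg _ _ (ltW bt)); ring.
  rewrite (le_trans (ler_wpM2l (ltW (weight_gt0 _ _)) (ler_normB _ _)))// mulrDr.
  apply: lerD.
    rewrite (le_trans (ler_wpM2r (normr_ge0 _) (wb t _))) ?bt//.
    rewrite -mulrA ler_pM2l ?exprn_gt0//; apply: le_trans (le1sq _).
    by rewrite /p normrM (gtr0_norm (weight_gt0 _ _)).
  have igI : mu.-integrable I (EFin \o g) by exact: integrableS ig.
  have igb : mu.-integrable `]b, t] (EFin \o g) by exact: integrableS ig.
  have iga : mu.-integrable I (EFin \o (fun u => `|g u|)).
    by have /integrable_norm := igI.
  apply: (@le_trans _ _ (weight N b * \int[mu]_(u in I) `|g u|)).
    rewrite ler_pM2l ?weight_gt0// (le_trans (le_normr_Rintegral _ igb))//.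
    rewrite /Rintegral fine_le//.
    - by apply: integrable_fin_num => //; have /integrable_norm := igb.
    - exact: integrable_fin_num.
    - apply: ge0_subset_integral => //.
      + by case/integrableP : iga.
      + by apply: subset_itvl; rewrite bnd_simp.
  rewrite -RintegralZl//; apply: le_trans (ler_wpM2l _ hB); last by rewrite exprn_ge0.
  rewrite -RintegralZl//; apply: le_Rintegral => //.
  - exact: RintegrableZl.
  - exact: RintegrableZl.
  - move=> u; rewrite /I /= in_itv/= => bu.
    rewrite (le_trans (ler_wpM2r (normr_ge0 _) (wb u bu)))//.
    rewrite -mulrA ler_pM2l ?exprn_gt0//; apply: le_trans (le1sq _).
    by rewrite /q normrM (gtr0_norm (weight_gt0 _ _)).
rewrite -[leLHS]I1.
have i2 : mu.-integrable I (EFin \o (fun t => 2 ^+ N * (1 + p t ^+ 2))) by exact: RintegrableZl.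
apply: (@le_trans _ _ (\int[mu]_(t in I) (2 ^+ N * (1 + p t ^+ 2) + 2 ^+ N * (1 + B)))).
  apply: le_Rintegral => //.
  exact: (RintegrableD mI i2 (c1 _)).
rewrite (RintegralD (mu := mu) mI i2 (c1 _)); apply: lerD; last by rewrite [leLHS]I1.
by rewrite RintegralZl// ler_pM2l ?exprn_gt0.
Qed.

Lemma weighted_L2_ae N f g : measurable_fun setT g ->
  {ae mu, forall t, f t = g t} -> weighted_L2 N f -> weighted_L2 N g.
Proof.
move=> mg fg [mf wf]; split=> // l lN; have /integrableP[_ fin] := wf l lN.
have m (h : R -> R) : measurable_fun setT h ->
    measurable_fun setT (fun t : R => ((t ^+ l * h t) ^+ 2)%:E).
  move=> mh; apply/measurable_EFinP/measurable_funX/measurable_funM => //.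
apply/integrableP; split; first exact: m.
rewrite (le_lt_trans _ fin)// le_eqVlt; apply/orP; left; apply/eqP.
apply: ge0_ae_eq_integral => //.
- by apply: measurableT_comp => //; exact: m.
- by apply: measurableT_comp => //; exact: m.
- by apply: filterS fg => [|t ft _ /=]; [exact: (ae_filter_ringOfSetsType mu)|rewrite ft].
Qed.

Lemma Rintegral_ae (D : set R) f g : measurable D -> measurable_fun setT f ->
  measurable_fun setT g -> {ae mu, forall t, f t = g t} ->
  \int[mu]_(t in D) f t = \int[mu]_(t in D) g t.
Proof.
move=> mD mf mg fg; congr fine; apply: ae_eq_integral => //.
- by apply/measurable_EFinP; exact: measurable_funTS.
- by apply/measurable_EFinP; exact: measurable_funTS.
- by apply: filterS fg => [|t ft _ /=]; [exact: (ae_filter_ringOfSetsType mu)|rewrite ft].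
Qed.

(** The continuous representative of g k is a primitive of g (k + 1), which may
    be replaced by its own continuous representative when k + 1 < N; the
    fundamental theorem of calculus then gives a classical derivative. *)
Lemma smooth_representative (N : nat) (f : R -> R) (g : nat -> R -> R) :
  (1 < N)%N -> locally_integrable setT f ->
  (forall phi, test_function phi ->
    \int[mu]_t (f t * phi t) = \int[mu]_t (g 0%N t * phi t)) ->
  (forall k, (k <= N)%N -> locally_integrable setT (g k)) ->
  (forall k, (k <= N)%N -> weighted_L2 N (g k)) ->
  (forall k, (k < N)%N -> weak_deriv (g k) (g k.+1)) ->
  exists F : nat -> R -> R,
  [/\ {ae mu, forall t, f t = F 0%N t},
      forall k, (k < N)%N -> continuous (F k),
      forall k, (k < N)%N -> exists C : R, forall t, weight N t * `|F k t| <= C &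
      forall k (t : R), (k.+1 < N)%N -> is_derive t 1 (F k) (F k.+1 t)].
Proof.
move=> N1 lf fg0 lg wg dg; have N0 : (0 < N)%N by exact: ltnW.
have ig k : (k <= N)%N -> mu.-integrable setT (EFin \o g k).
  by move=> kN; apply: weighted_L2_integrable (wg k kN).
have /choice[c hc] : forall k, exists c, (k < N)%N ->
    {ae mu, forall t, g k t = primitive c (g k.+1) t}.
  move=> k; have [kN|kN] := ltnP k N; last by exists 0.
  by have [c hc] := weak_deriv_primitive (lg k (ltnW kN)) (ig _ kN) (dg k kN); exists c.
pose F k := primitive (c k) (g k.+1).
have cF k : (k < N)%N -> continuous (F k) by move=> kN; exact/continuous_primitive/ig.
have mF k : (k < N)%N -> measurable_fun setT (F k).
  by move=> kN; apply: continuous_measurable_fun; exact: cF.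
have wF k : (k < N)%N -> weighted_L2 N (F k).
  by move=> kN; apply: (weighted_L2_ae (mF k kN) (hc k kN)); exact/wg/ltnW.
exists F; split => //.
- have h0 := weak_unique lf (lg 0%N (leq0n _)) fg0.
  apply: filterS2 h0 (hc 0%N N0); first exact: (ae_filter_ringOfSetsType mu).
  by move=> t -> ->.
- move=> k kN; apply: (decay (wF k kN) (wg k.+1 kN) (ig _ kN)) => a b ab.
  by apply: primitiveB => //; exact: ig.
- move=> k t kN.
  have -> : F k = primitive (c k) (F k.+1).
    apply/funext => u; rewrite /F /primitive; congr (_ + _).
    apply: Rintegral_ae => //; [by case: (wg k.+1 (ltnW kN))|exact: mF|exact: hc].
  apply: is_derive_primitive; last exact: cF.
  by apply: weighted_L2_integrable (wF _ kN).
Qed.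

End Decay.
(** * Correlation with a translated and dilated function *)
Section Transform.
Context {R : realType}.
Local Notation mu := (@lebesgue_measure R).
Implicit Types (s G H : R -> R) (x y t : R).

Definition decays (m : nat) G :=
  continuous G /\ exists C : R, forall t, weight m t * `|G t| <= C.

Lemma decaysW m n G : (m <= n)%N -> decays n G -> decays m G.
Proof.
move=> mn [cG [C hC]]; split=> //; exists C => t; apply: le_trans (hC t).
rewrite ler_wpM2r// /weight ler_weXn2l//; have := normr_ge0 t; lra.
Qed.

Lemma decaysD m G H : decays m G -> decays m H -> decays m (fun t => G t + H t).
Proof.
move=> [cG [C hC]] [cH [D hD]]; split.
  by move=> t; apply: (@continuousD _ R^o); [exact: cG|exact: cH].
exists (C + D) => t; apply: (le_trans _ (lerD (hC t) (hD t))).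
by rewrite -mulrDr ler_wpM2l ?ler_normD// ltW// weight_gt0.
Qed.

Lemma decays_mul_id m G : decays m.+1 G -> decays m (fun t => t * G t).
Proof.
move=> [cG [C hC]]; split.
  by move=> t; apply: continuousM; [exact: cvg_id|exact: cG].
exists C => t; apply: le_trans (hC t).
rewrite /weight exprSr -!mulrA normrM ler_wpM2l ?exprn_ge0 ?addr_ge0//.
by rewrite ler_wpM2r// lerDr.
Qed.

(** The neighbourhood of (x0, y0) on which a single dominating function serves;
    the lower bound y0 / 2 keeps the dilations away from 0. *)
Definition near_scale (x0 y0 x y : R) :=
  (x0 - 1 < x < x0 + 1) && (y0 / 2 < y < 2 * y0).

Lemma near_scale_refl x0 y0 : 0 < y0 -> near_scale x0 y0 x0 y0.
Proof. by move=> y00; rewrite /near_scale; apply/andP; split; apply/andP; split; lra. Qed.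

(** With u = (t - x) / y one has 1 + |t| <= M * (1 + |u|), where M depends on
    (x0, y0) only. *)
Lemma decays_dominated G x0 y0 : 0 < y0 -> decays 1 G -> exists K : R,
  forall x y t, near_scale x0 y0 x y -> `|G ((t - x) / y)| <= K / (1 + `|t|).
Proof.
move=> y00 [_ [C hC]].
(* |t| <= |x| + y * |u|, with |x| <= |x0| + 1 and y <= 2 * y0. *)
exists (C * (2 + `|x0| + 2 * y0)) => x y t /andP[/andP[x1 x2] /andP[y1 y2]].
have y_gt0 : 0 < y by lra.
have := hC ((t - x) / y); set u := (t - x) / y.
have tE : t = u * y + x by rewrite /u divfK ?gt_eqF// subrK.
have xle : `|x| <= `|x0| + 1.
  rewrite -[x](subrK x0) addrC (le_trans (ler_normD _ _))// lerD2l.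
  by rewrite ler_norml; apply/andP; split; lra.
have tle : `|t| <= `|u| * y + `|x|.
  by rewrite {1}tE (le_trans (ler_normD _ _))// normrM (gtr0_norm y_gt0).
rewrite /weight expr1 => hu.
have t1 : 0 < 1 + `|t| by rewrite ltr_pwDl.
rewrite ler_pdivlMr//.
have u0 := normr_ge0 u; have g0 := normr_ge0 (G u).
have uy : `|u| * y <= `|u| * (2 * y0) by rewrite ler_wpM2l// ltW.
have hM : 1 + `|t| <= (1 + `|u|) * (2 + `|x0| + 2 * y0).
  have := normr_ge0 x0; nra.
apply: (@le_trans _ _ (`|G u| * ((1 + `|u|) * (2 + `|x0| + 2 * y0)))).
  by rewrite ler_wpM2l.
rewrite mulrA [`|G u| * _]mulrC ler_wpM2r//; have := normr_ge0 x0; lra.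
Qed.

Lemma integrable_dominant s (K : R) : square_integrable s ->
  mu.-integrable setT (EFin \o (fun t => `|s t| * (K / (1 + `|t|)))).
Proof.
move=> [ms is2]; apply: integrable_prod_L2.
  split; first exact: measurableT_comp.
  by rewrite (_ : (fun t => `|s t| ^+ 2) = (fun t => s t ^+ 2))//; apply/funext => t;
    rewrite real_normK ?num_real.
have c : continuous (fun t : R => K / (1 + `|t|)).
  move=> t; apply: cvgM; first exact: cvg_cst.
  apply: cvgV; first by rewrite gt_eqF// ltr_pwDl.
  by apply: cvgD; [exact: cvg_cst|exact: norm_continuous].
split; first exact: continuous_measurable_fun.
apply: (@Rintegrable_le _ _ _ (fun t => K ^+ 2 * (1 + t ^+ 2)^-1)) => //.
- by apply: measurable_funX; exact: continuous_measurable_fun.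
- move=> t _; rewrite ger0_norm ?sqr_ge0// exprMn ler_wpM2l ?sqr_ge0// exprVn.
  rewrite lef_pV2 ?posrE ?exprn_gt0 ?ltr_pwDl ?sqr_ge0//.
  by rewrite -(real_normK (num_real t)); have := normr_ge0 t; nra.
- by apply: RintegrableZl => //; exact: integrable_oneDsqrV.
Qed.

Definition correlation s G x y := \int[mu]_t (s t * G ((t - x) / y)).

Lemma continuous_scaled G x y : continuous G -> continuous (fun t => G ((t - x) / y)).
Proof.
move=> cG t; apply: (continuous_comp (f := fun t => (t - x) / y)); last exact: cG.
apply: cvgM; last exact: cvg_cst.
by apply: cvgB; [exact: cvg_id|exact: cvg_cst].
Qed.

Lemma integrable_correlation s G x y : square_integrable s -> decays 1 G -> 0 < y ->
  mu.-integrable setT (EFin \o (fun t => s t * G ((t - x) / y))).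
Proof.
move=> ss dG y0; have [K hK] := decays_dominated x y0 dG.
apply: (@Rintegrable_le _ _ _ (fun t => `|s t| * (K / (1 + `|t|)))) => //.
- apply: measurable_funM; first by case: ss.
  by apply: continuous_measurable_fun; apply: continuous_scaled; case: dG.
- by move=> t _; rewrite normrM ler_wpM2l// hK// near_scale_refl.
- exact: integrable_dominant.
Qed.

Lemma correlation_bounded s G x0 y0 : square_integrable s -> decays 1 G -> 0 < y0 ->
  exists B : R, forall x y, near_scale x0 y0 x y -> `|correlation s G x y| <= B.
Proof.
move=> ss dG y00; have [K hK] := decays_dominated x0 y00 dG.
exists (\int[mu]_t (`|s t| * (K / (1 + `|t|)))) => x y xy.
have y_gt0 : 0 < y by move: xy => /andP[_ /andP[]]; lra.
have ic := integrable_correlation x ss dG y_gt0.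
apply: (le_trans (le_normr_Rintegral _ ic)) => //.
apply: le_Rintegral => //.
- by have /integrable_norm := ic.
- exact: integrable_dominant.
- by move=> t _; rewrite normrM ler_wpM2l// hK.
Qed.

Lemma continuous_correlation_x s G x y : square_integrable s -> decays 1 G -> 0 < y ->
  {for x, continuous (fun x => correlation s G x y)}.
Proof.
move=> ss dG y0; have [K hK] := decays_dominated x y0 dG.
apply: (@continuity_under_integral R _ _ mu (fun x t => s t * G ((t - x) / y))
  setT measurableT (x - 1) (x + 1) _ _ (fun t => `|s t| * (K / (1 + `|t|)))).
- by move=> z _; exact: integrable_correlation.
- apply: aeW => t _ z _; apply: cvgM; first exact: cvg_cst.
  apply: (continuous_comp (f := fun z => (t - z) / y)); last by case: dG => + _; apply.
  apply: cvgM; last exact: cvg_cst.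
  by apply: cvgB; [exact: cvg_cst|exact: cvg_id].
- exact: integrable_dominant.
- move=> z; rewrite /= in_itv/= => zx; apply: aeW => t _.
  rewrite normrM ler_wpM2l// hK// /near_scale zx/=; apply/andP; split; lra.
- rewrite inE/= in_itv/=; apply/andP; split; lra.
Qed.

Lemma continuous_correlation_y s G x y : square_integrable s -> decays 1 G -> 0 < y ->
  {for y, continuous (correlation s G x)}.
Proof.
move=> ss dG y0; have [K hK] := decays_dominated x y0 dG.
apply: (@continuity_under_integral R _ _ mu (fun y t => s t * G ((t - x) / y))
  setT measurableT (y / 2) (2 * y) _ _ (fun t => `|s t| * (K / (1 + `|t|)))).
- by move=> z; rewrite /= in_itv/= => /andP[z1 z2]; apply: integrable_correlation => //;
  lra.
- apply: aeW => t _ z; rewrite inE/= in_itv/= => /andP[z1 z2].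
  have z0 : z != 0 by rewrite gt_eqF//; lra.
  have c : {for z, continuous (fun z : R => (t - x) / z)}.
    by apply: cvgM; [exact: cvg_cst|exact: cvgV].
  have cG : {for z, continuous (fun z : R => G ((t - x) / z))}.
    by apply: (continuous_comp c); case: dG => + _; apply.
  by apply: cvgM; [exact: cvg_cst|exact: cG].
- exact: integrable_dominant.
- move=> z; rewrite /= in_itv/= => zy; apply: aeW => t _.
  rewrite normrM ler_wpM2l// hK// /near_scale zy andbT; apply/andP; split; lra.
- rewrite inE/= in_itv/=; apply/andP; split; lra.
Qed.

Lemma is_derive_under_integral (f df : R -> R -> R) (g : R -> R) (a u v : R) :
  u < a < v ->
  (forall x, u < x < v -> mu.-integrable setT (EFin \o f x)) ->
  (forall x t, u < x < v -> is_derive x 1 (f ^~ t) (df x t)) ->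
  mu.-integrable setT (EFin \o g) ->
  (forall x t, u < x < v -> `|df x t| <= g t) ->
  is_derive a 1 (fun x => \int[mu]_t f x t) (\int[mu]_t df a t).
Proof.
move=> uav intf dfE intg dfg.
have Ia : `]u, v[%classic a by rewrite /= in_itv.
have g0 t : 0 <= g t by apply: le_trans (dfg a t uav).
have intf' x : `]u, v[%classic x -> mu.-integrable setT (EFin \o f x).
  by rewrite /= in_itv; exact: intf.
have der x t : `]u, v[%classic x -> setT t -> derivable (f ^~ t) x 1.
  by rewrite /= in_itv => xuv _; have [] := dfE x t xuv.
have d1E x t : u < x < v -> partial1of2 f x t = df x t.
  by move=> xuv; rewrite partial1of2E; have [_ ->] := dfE x t xuv.
have bnd x t : `]u, v[%classic x -> setT t -> `|partial1of2 f x t| <= g t.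
  by rewrite /= in_itv => xuv _; rewrite d1E//; exact: dfg.
split.
  exact: (@derivable_under_integral R _ _ mu f setT measurableT
    a u v Ia intf' der g g0 intg bnd).
rewrite -derive1E (@differentiation_under_integral R _ _ mu f setT measurableT
  a u v Ia intf' der g g0 intg bnd).
by apply: eq_Rintegral => t _; rewrite d1E.
Qed.

(** The x-derivative of G ((t - x) / y) is - 1 / y times G' ((t - x) / y). *)
Lemma is_derive_correlation_x s G G' x y : square_integrable s -> decays 1 G ->
  decays 1 G' -> (forall t, is_derive t 1 G (G' t)) -> 0 < y ->
  is_derive x 1 (fun x => correlation s G x y) (- y^-1 * correlation s G' x y).
Proof.
move=> ss dG dG' GG' y0; have [K hK] := decays_dominated x y0 dG'.
have := @is_derive_under_integral (fun x t => s t * G ((t - x) / y))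
  (fun x t => - y^-1 * (s t * G' ((t - x) / y)))
  (fun t => y^-1 * (`|s t| * (K / (1 + `|t|)))) x (x - 1) (x + 1).
rewrite RintegralZl//; last exact: integrable_correlation.
apply.
- by apply/andP; split; lra.
- by move=> z _; exact: integrable_correlation.
- move=> z t _; have h : is_derive z 1 (fun z => (t - z) / y) (- y^-1).
    rewrite (_ : (fun z => (t - z) / y) = (fun z => - y^-1 * z + t / y)); last first.
      by apply/funext => w; ring.
    have := @is_derive_affine _ id (- y^-1) (t / y) z 1 (is_derive_id _ _).
    by rewrite mulr1.
  have h2 := @is_derive1_comp R G (fun z => (t - z) / y) z _ _ (GG' _) h.
  have h3 := is_deriveZ (s t) h2.
  by apply: (is_derive_eq h3); rewrite /GRing.scale/=; ring.
- by apply: RintegrableZl => //; exact: integrable_dominant.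
- move=> z t zx; rewrite normrM normrN (gtr0_norm (x := y^-1)) ?invr_gt0//.
  rewrite ler_pM2l ?invr_gt0// normrM ler_wpM2l// hK// /near_scale zx/=.
  apply/andP; split; lra.
Qed.

(** The y-derivative of G ((t - x) / y) is - 1 / y times H ((t - x) / y) with
    H u = u * G' u: this is where a power of t is lost. On the neighbourhood
    1 / y is at most 2 / y0, hence the factor in the dominating function. *)
Lemma is_derive_correlation_y s G G' x y : square_integrable s -> decays 1 G ->
  decays 1 (fun t => t * G' t) -> (forall t, is_derive t 1 G (G' t)) -> 0 < y ->
  is_derive y 1 (correlation s G x)
    (- y^-1 * correlation s (fun t => t * G' t) x y).
Proof.
move=> ss dG dG' GG' y0; have [K hK] := decays_dominated x y0 dG'.
have := @is_derive_under_integral (fun y t => s t * G ((t - x) / y))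
  (fun y t => - y^-1 * (s t * ((t - x) / y * G' ((t - x) / y))))
  (fun t => 2 / y * (`|s t| * (K / (1 + `|t|)))) y (y / 2) (2 * y).
rewrite RintegralZl//; last exact: (@integrable_correlation s (fun t => t * G' t)).
apply.
- by apply/andP; split; lra.
- by move=> z /andP[z1 z2]; apply: integrable_correlation => //; lra.
- move=> z t /andP[z1 z2]; have z0 : z != 0 by rewrite gt_eqF//; lra.
  have h : is_derive z 1 (fun z => (t - x) / z) (- z^-1 * ((t - x) / z)).
    have h := is_deriveZ (t - x) (is_deriveV z0 (is_derive_id z 1)).
    by apply: (is_derive_eq h); rewrite /GRing.scale/=; field.
  have h2 := @is_derive1_comp R G (fun z => (t - x) / z) z _ _ (GG' _) h.
  have h3 := is_deriveZ (s t) h2.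
  by apply: (is_derive_eq h3); rewrite /GRing.scale/=; ring.
- by apply: RintegrableZl => //; exact: integrable_dominant.
- move=> z t /andP[z1 z2]; have z0 : 0 < z by lra.
  rewrite normrM normrN (gtr0_norm (x := z^-1)) ?invr_gt0//.
  apply: ler_pM => //; first by rewrite invr_ge0 ltW.
    by rewrite -[2 / y]invrK invf_div lef_pV2 ?posrE ?divr_gt0//; lra.
  rewrite normrM ler_wpM2l// hK// /near_scale z1 z2 andbT.
  by apply/andP; split; lra.
Qed.

(** Joint continuity follows from continuity in y alone, because the x-derivative
    is bounded near the point: by the mean value theorem the function is
    Lipschitz in x, uniformly in y. *)
Lemma continuous_correlation s G G' x y : square_integrable s -> decays 1 G ->
  decays 1 G' -> (forall t, is_derive t 1 G (G' t)) -> 0 < y ->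
  {for (x, y), continuous (fun p => correlation s G p.1 p.2)}.
Proof.
move=> ss dG dG' GG' y0.
have [B hB] := correlation_bounded x ss dG' y0.
have cy : {for y, continuous (correlation s G x)} by exact: continuous_correlation_y.
have lip z w : near_scale x y z w ->
    `|correlation s G z w - correlation s G x w| <= 2 / y * `|B| * `|z - x|.
  move=> /andP[/andP[z1 z2] /andP[w1 w2]]; have w0 : 0 < w by lra.
  have D u := is_derive_correlation_x u ss dG dG' GG' w0.
  have key a b : x - 1 < a -> a <= b -> b < x + 1 ->
      `|correlation s G b w - correlation s G a w| <= 2 / y * `|B| * `|b - a|.
    move=> a1 ab b1.
    have cw : {within `[a, b], continuous (fun x => correlation s G x w)}.
      apply: continuous_subspaceT => u; exact: continuous_correlation_x.
    have [c] := MVT_segment ab (fun u _ => D u) cw.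
    rewrite in_itv/= => /andP[c1 c2] ->; rewrite normrM ler_wpM2r// normrM normrN.
    rewrite (gtr0_norm (x := w^-1)) ?invr_gt0//; apply: ler_pM => //.
    - by rewrite invr_ge0 ltW.
    - by rewrite -[2 / y]invrK invf_div lef_pV2 ?posrE ?divr_gt0//; lra.
    - apply: (le_trans (hB c w _)); last exact: ler_norm.
      by rewrite /near_scale w1 w2; apply/andP; split => //; apply/andP; split; lra.
  have [xz|zx] := leP x z; first by apply: key => //; lra.
  by rewrite distrC [`|z - x|]distrC; apply: key; lra.
apply/cvgrPdist_le => e e0.
have e20 : 0 < e / 2 by rewrite divr_gt0.
move/cvgrPdist_le : cy => /(_ _ e20); rewrite nearE => -[d /= d0 hd].
pose M := 2 / y * `|B| + 1.
have M0 : 0 < M by rewrite ltr_wpDl// mulr_ge0// divr_ge0// ltW.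
have [r r0 [r1 r2 r3 r4]] : exists2 r, 0 < r & [/\ r <= 1, r <= y / 2, r <= d & M * r <= e / 2].
  exists (Num.min (Num.min 1 (y / 2)) (Num.min d (e / 2 / M))).
    by rewrite !lt_min ltr01 d0 (divr_gt0 e20 M0) divr_gt0.
  split; rewrite ?ge_min ?lexx ?orbT//.
  by rewrite mulrC -ler_pdivlMr// !ge_min lexx !orbT.
rewrite nearE; exists (ball x r, ball y r); first by split; exact: nbhsx_ballx.
move=> [z w] /= [zx wy]; move: (zx) (wy); rewrite /ball/= => zx' wy'.
have near : near_scale x y z w.
  move: zx' wy'; rewrite !ltr_norml => /andP[? ?] /andP[? ?].
  by rewrite /near_scale; apply/andP; split; apply/andP; split; lra.
have h1 := lip z w near.
have h2 : `|correlation s G x y - correlation s G x w| <= e / 2.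
  by apply: hd; rewrite /ball_ /=; apply: lt_le_trans wy' r3.
rewrite -[_ - _](subrKA (correlation s G x w)) (le_trans (ler_normD _ _))//.
rewrite [leRHS](splitr e); apply: lerD => //.
rewrite distrC (le_trans h1)// (le_trans _ r4)//; apply: ler_pM => //.
- by rewrite mulr_ge0// divr_ge0// ltW.
- by rewrite lerDl.
- by rewrite distrC ltW.
Qed.

End Transform.
(** * Regularity of the transform on the half plane *)
Section HalfPlane.
Context {R : realType}.
Local Notation mu := (@lebesgue_measure R).
Implicit Types (s G H P Q : R -> R) (x y t : R) (u ux uy uxx uyy : R -> R -> R).

(** Only those continuity properties of the partial derivatives are recorded that
    the poles need: each is taken along the direction transverse to the
    differentiation. *)
Definition C1_half_plane u ux uy := forall x y, 0 < y ->
  [/\ is_derive x 1 (fun x => u x y) (ux x y),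
      is_derive y 1 (fun y => u x y) (uy x y),
      {for (x, y), continuous (fun p => u p.1 p.2)},
      {for y, continuous (fun y => ux x y)} &
      {for x, continuous (fun x => uy x y)}].

Definition C2_on_lines ux uy uxx uyy := forall x y, 0 < y ->
  [/\ is_derive x 1 (fun x => ux x y) (uxx x y),
      {for x, continuous (fun x => uxx x y)},
      is_derive y 1 (fun y => uy x y) (uyy x y) &
      {for y, continuous (fun y => uyy x y)}].

Definition lincomb (a b : R) u v := fun x y => a * u x y + b * v x y.

Lemma is_derive_lincomb (a b : R) (f g : R -> R) (t df dg : R) :
  is_derive t 1 f df -> is_derive t 1 g dg ->
  is_derive t 1 (fun t => a * f t + b * g t) (a * df + b * dg).
Proof.
move=> df' dg'; have h := is_deriveD (is_deriveZ a df') (is_deriveZ b dg').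
exact: (is_derive_eq h).
Qed.

Lemma continuous_lincomb (T : topologicalType) (a b : R) (f g : T -> R) (z : T) :
  {for z, continuous f} -> {for z, continuous g} ->
  {for z, continuous (fun z => a * f z + b * g z)}.
Proof.
by move=> cf cg; apply: cvgD; apply: cvgM;
  [exact: cvg_cst|exact: cf|exact: cvg_cst|exact: cg].
Qed.

Arguments is_derive_lincomb a b {f g t df dg}.
Arguments continuous_lincomb {T} a b {f g z}.

Lemma continuous_ext (f g : R -> R) (z : R) : (forall t, f t = g t) ->
  {for z, continuous f} -> {for z, continuous g}.
Proof. by move=> /funext ->. Qed.

Lemma C1_lincomb (a b : R) u ux uy v vx vy : C1_half_plane u ux uy ->
  C1_half_plane v vx vy ->
  C1_half_plane (lincomb a b u v) (lincomb a b ux vx) (lincomb a b uy vy).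
Proof.
move=> hu hv x y y0; have [u1 u2 u3 u4 u5] := hu x y y0.
have [v1 v2 v3 v4 v5] := hv x y y0.
by split; [exact: is_derive_lincomb|exact: is_derive_lincomb|
  exact: continuous_lincomb|exact: continuous_lincomb|exact: continuous_lincomb].
Qed.

Lemma C2_lincomb (a b : R) ux uy uxx uyy vx vy vxx vyy :
  C2_on_lines ux uy uxx uyy -> C2_on_lines vx vy vxx vyy ->
  C2_on_lines (lincomb a b ux vx) (lincomb a b uy vy)
    (lincomb a b uxx vxx) (lincomb a b uyy vyy).
Proof.
move=> hu hv x y y0; have [u1 u2 u3 u4] := hu x y y0.
have [v1 v2 v3 v4] := hv x y y0.
by split; [exact: is_derive_lincomb|exact: continuous_lincomb|
  exact: is_derive_lincomb|exact: continuous_lincomb].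
Qed.

(** The wavelet transform for real functions. *)
Definition transform s G x y := (Num.sqrt y)^-1 * correlation s G x y.

Definition transform_x s G' x y := - y^-1 * transform s G' x y.

Definition transform_y s G G' x y :=
  - (2 * y)^-1 * transform s G x y - y^-1 * transform s (fun t => t * G' t) x y.

Lemma is_derive_sqrtV y : 0 < y ->
  is_derive y 1 (fun y => (Num.sqrt y)^-1) (- (2 * y)^-1 * (Num.sqrt y)^-1).
Proof.
move=> y0; have s0 : Num.sqrt y != 0 by rewrite gt_eqF// sqrtr_gt0.
have h := is_deriveV s0 (is_derive1_sqrt y0).
apply: (is_derive_eq h); rewrite /GRing.scale/=.
by rewrite sqr_sqrtr ?ltW// !invfM; ring.
Qed.

Lemma continuous_sqrtV y : 0 < y -> {for y, continuous (fun y => (Num.sqrt y)^-1)}.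
Proof.
move=> y0; apply: cvgV; first by rewrite gt_eqF// sqrtr_gt0.
exact: sqrt_continuous.
Qed.

Lemma continuous_transform_x s G x y : square_integrable s -> decays 1 G -> 0 < y ->
  {for x, continuous (fun x => transform s G x y)}.
Proof.
move=> ss dG y0; apply: cvgM; first exact: cvg_cst.
exact: continuous_correlation_x.
Qed.

Lemma continuous_transform_y s G x y : square_integrable s -> decays 1 G -> 0 < y ->
  {for y, continuous (fun y => transform s G x y)}.
Proof.
move=> ss dG y0; apply: cvgM; first exact: continuous_sqrtV.
exact: continuous_correlation_y.
Qed.

Lemma is_derive_transform_x s G G' x y : square_integrable s -> decays 1 G ->
  decays 1 G' -> (forall t, is_derive t 1 G (G' t)) -> 0 < y ->
  is_derive x 1 (fun x => transform s G x y) (transform_x s G' x y).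
Proof.
move=> ss dG dG' GG' y0.
have h := is_deriveZ (Num.sqrt y)^-1 (is_derive_correlation_x x ss dG dG' GG' y0).
by apply: (is_derive_eq h); rewrite /transform_x /transform /GRing.scale/=; ring.
Qed.

Lemma is_derive_transform_y s G G' x y : square_integrable s -> decays 1 G ->
  decays 1 (fun t => t * G' t) -> (forall t, is_derive t 1 G (G' t)) -> 0 < y ->
  is_derive y 1 (fun y => transform s G x y) (transform_y s G G' x y).
Proof.
move=> ss dG dG' GG' y0.
have h := is_deriveM (is_derive_sqrtV y0) (is_derive_correlation_y x ss dG dG' GG' y0).
by apply: (is_derive_eq h); rewrite /transform_y /transform /GRing.scale/=; ring.
Qed.

Lemma continuous_transform_yx s G G' x y : square_integrable s -> decays 1 G ->
  decays 1 (fun t => t * G' t) -> 0 < y ->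
  {for x, continuous (fun x => transform_y s G G' x y)}.
Proof.
move=> ss dG dG' y0; apply: cvgB; apply: cvgM; try exact: cvg_cst.
- exact: continuous_transform_x.
- exact: continuous_transform_x.
Qed.

Lemma continuous_mulV (c y : R) (f : R -> R) : 0 < y -> c != 0 ->
  {for y, continuous f} -> {for y, continuous (fun y => (c * y)^-1 * f y)}.
Proof.
move=> y0 c0 cf; apply: cvgM; last exact: cf.
apply: cvgV; first by rewrite mulf_neq0// gt_eqF.
by apply: cvgM; [exact: cvg_cst|exact: cvg_id].
Qed.

Lemma continuous_transform_yy s G G' x y : square_integrable s -> decays 1 G ->
  decays 1 (fun t => t * G' t) -> 0 < y ->
  {for y, continuous (fun y => transform_y s G G' x y)}.
Proof.
move=> ss dG dG' y0.
have n2 : (2 : R) != 0 by [].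
have c1 := continuous_mulV y0 n2 (continuous_transform_y (x := x) ss dG y0).
have c2 := continuous_mulV y0 (oner_neq0 R) (continuous_transform_y (x := x) ss dG' y0).
apply: continuous_ext (continuous_lincomb (-1) (-1) c1 c2) => z.
by rewrite /transform_y mul1r; ring.
Qed.

Lemma C1_transform s G G' : square_integrable s -> decays 2 G -> decays 2 G' ->
  (forall t, is_derive t 1 G (G' t)) ->
  C1_half_plane (transform s G) (transform_x s G') (transform_y s G G').
Proof.
move=> ss dG2 dG2' GG' x y y0.
have dG := decaysW (isT : (1 <= 2)%N) dG2; have dG' := decaysW (isT : (1 <= 2)%N) dG2'.
have dTG' := decays_mul_id dG2'.
split.
- exact: is_derive_transform_x.
- exact: is_derive_transform_y.
- apply: cvgM; last exact: (continuous_correlation ss dG dG' GG' y0).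
  apply: (continuous_comp (f := snd) (g := fun y => (Num.sqrt y)^-1)).
    exact: cvg_snd.
  exact: continuous_sqrtV.
- have n1 : (- 1 : R) != 0 by rewrite oppr_eq0 oner_neq0.
  apply: continuous_ext (continuous_mulV y0 n1 (continuous_transform_y (x := x) ss dG' y0)).
  by move=> z; rewrite /transform_x mulN1r invrN.
- exact: continuous_transform_yx.
Qed.

(** The y-derivative involves the transform for H t = t * G' t, whose derivative
    is G' + t * G''. Differentiating once more in y asks for t * (G' + t * G'') to
    decay like 1 / |t|, that is for a cubic decay of G''. *)
Lemma C2_transform s G G' G'' : square_integrable s -> decays 3 G -> decays 3 G' ->
  decays 3 G'' -> (forall t, is_derive t 1 G (G' t)) ->
  (forall t, is_derive t 1 G' (G'' t)) ->
  exists uxx uyy, C2_on_lines (transform_x s G') (transform_y s G G') uxx uyy.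
Proof.
move=> ss dG dG' dG'' GG' GG''.
pose H t := t * G' t; pose H' t := G' t + t * G'' t.
have dH : decays 2 H by exact: decays_mul_id.
have HH' t : is_derive t 1 H (H' t).
  have h := is_deriveM (is_derive_id t 1) (GG'' t).
  by apply: (is_derive_eq h); rewrite /H' /GRing.scale/= mulr1 addrC.
have dH' : decays 2 H'.
  by apply: decaysD; [exact: decaysW dG'|exact: decays_mul_id].
have le12 : (1 <= 2)%N by []. have le13 : (1 <= 3)%N by []. have le23 : (2 <= 3)%N by [].
exists (fun x y => - y^-1 * transform_x s G'' x y).
exists (fun x y => 2 * (2 * y) ^- 2 * transform s G x y - (2 * y)^-1 * transform_y s G G' x y
  + (y ^- 2 * transform s H x y - y^-1 * transform_y s H H' x y)).
have dG1 := decaysW le13 dG; have dG1' := decaysW le13 dG'.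
have dG1'' := decaysW le13 dG''; have dH1 := decaysW le12 dH.
have dTG' : decays 1 (fun t => t * G' t) by [].
have dTH' : decays 1 (fun t => t * H' t) by exact: decays_mul_id.
move=> x y y0; have yn0 : y != 0 by rewrite gt_eqF.
split.
- have h := is_deriveZ (- y^-1) (is_derive_transform_x x ss dG1' dG1'' GG'' y0).
  exact: (is_derive_eq h).
- apply: cvgM; first exact: cvg_cst.
  by apply: cvgM; [exact: cvg_cst|exact: continuous_transform_x].
- have hG := is_derive_transform_y x ss dG1 dTG' GG' y0.
  have hH := is_derive_transform_y x ss dH1 dTH' HH' y0.
  have y20 : 2 * y != 0 by rewrite mulf_neq0.
  have i2 : is_derive y 1 (fun y => (2 * y)^-1) (- (2 * y) ^- 2 * 2).
    have h := is_deriveV (f := fun y => 2 * y) y20 (is_deriveZ 2 (is_derive_id y 1)).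
    by apply: (is_derive_eq h); rewrite /GRing.scale/= mulr1.
  have i1 : is_derive y 1 (fun y => y^-1) (- y ^- 2).
    by have h := is_deriveV yn0 (is_derive_id y 1); apply: (is_derive_eq h);
      rewrite /GRing.scale/= mulr1.
  have h := is_derive_lincomb (-1) (-1) (is_deriveM i2 hG) (is_deriveM i1 hH).
  have -> : (fun y => transform_y s G G' x y) = (fun t => -1 * ((2 * t)^-1 * transform s G x t) +
      -1 * (t^-1 * transform s H x t)).
    by apply/funext => t; rewrite /transform_y /H; ring.
  by apply: (is_derive_eq h); rewrite /GRing.scale/=; ring.
- have n2 : (2 : R) != 0 by [].
  have cG := continuous_transform_y (x := x) ss dG1 y0.
  have cH := continuous_transform_y (x := x) ss dH1 y0.
  have cyG := continuous_transform_yy (x := x) ss dG1 dTG' y0.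
  have cyH := continuous_transform_yy (x := x) ss dH1 dTH' y0.
  have a1 := continuous_mulV y0 n2 (continuous_mulV y0 n2 cG).
  have a2 := continuous_mulV y0 n2 cyG.
  have b1 := continuous_mulV y0 (oner_neq0 R) (continuous_mulV y0 (oner_neq0 R) cH).
  have b2 := continuous_mulV y0 (oner_neq0 R) cyH.
  have c := continuous_lincomb 1 1 (continuous_lincomb 2 (-1) a1 a2)
    (continuous_lincomb 1 (-1) b1 b2).
  apply: continuous_ext c => z.
  by rewrite !mul1r -!exprVn; ring.
Qed.

End HalfPlane.
(** * From weak hypotheses on the wavelet to its transform *)
Section Representative.
Context {R : realType}.
Local Notation mu := (@lebesgue_measure R).
Implicit Types (f g : R -> R) (psi s : R -> R[i]) (x y t : R).

Lemma measurable_affine x y : measurable_fun setT (fun t : R => (t - x) / y).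
Proof. by apply: measurable_funM => //; exact: measurable_funB. Qed.

Lemma lebesgue_measure_affine x y (A : set R) : 0 < y -> measurable A ->
  mu A = (y^-1%:E * mu ((fun t => (t - x) / y)%R @^-1` A))%E.
Proof.
move=> y0 mA; have yV0 : 0 <= y^-1 by rewrite invr_ge0 ltW.
pose f : R -> measurableTypeR R := fun t => (t - x) / y.
have mf : measurable_fun setT f by exact: measurable_affine.
have := @lebesgue_measure_unique R (mscale (NngNum yV0)
  (measure_function_pushforward__canonical__measure_function_Measure mu mf)).
apply => //= _ [[a b]] _ <-; rewrite /mscale /=; rewrite /pushforward.
have -> : f @^-1` `]a, b]%classic = `](y * a + x), (y * b + x)]%classic.
  apply/seteqP; split => t /=; rewrite !in_itv/= /f ltr_pdivlMr// ler_pdivrMr//;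
    rewrite ltrBrDr lerBlDr ![y * _]mulrC//.
rewrite !lebesgue_measure_itv/= !lte_fin ltrD2r ltr_pM2l//.
case: ifPn => ab; last by rewrite mule0.
by rewrite -!EFinD -EFinM; congr EFin; field; rewrite gt_eqF.
Qed.

Lemma ae_affine x y f g : 0 < y -> {ae mu, forall t, f t = g t} ->
  {ae mu, forall t, f ((t - x) / y) = g ((t - x) / y)}.
Proof.
move=> y0 [N [mN N0 subN]].
exists ((fun t => (t - x) / y) @^-1` N); split.
- by rewrite -[X in measurable X]setTI; exact: measurable_affine.
- have := lebesgue_measure_affine x y0 mN; rewrite N0 => /esym/eqP.
  by rewrite mule_eq0 eqe invr_eq0 gt_eqF//= => /eqP.
- by move=> t /=; exact: subN.
Qed.

Lemma normc_sq (z : R[i]) : (Normc.normc z) ^+ 2 = complex.Re z ^+ 2 + complex.Im z ^+ 2.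
Proof. by case: z => a b /=; rewrite sqr_sqrtr// addr_ge0 ?sqr_ge0. Qed.

Lemma csquare_integrable_parts (h : R -> R[i]) : csquare_integrable h ->
  square_integrable (fun t => complex.Re (h t)) /\
  square_integrable (fun t => complex.Im (h t)).
Proof.
move=> [mr mi fin].
have ih : mu.-integrable setT (EFin \o (fun t => complex.Re (h t) ^+ 2 + complex.Im (h t) ^+ 2)).
  apply/integrableP; split.
    by apply/measurable_EFinP; apply: measurable_funD; exact: measurable_funX.
  under eq_integral do rewrite /= ger0_norm ?addr_ge0 ?sqr_ge0// -normc_sq.
  exact: fin.
split; split => //.
- apply: (Rintegrable_le _ _ _ ih) => //; first exact: measurable_funX.
  by move=> t _; rewrite ger0_norm ?sqr_ge0// lerDl sqr_ge0.
- apply: (Rintegrable_le _ _ _ ih) => //; first exact: measurable_funX.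
  by move=> t _; rewrite ger0_norm ?sqr_ge0// lerDr sqr_ge0.
Qed.

Lemma Re_mul_conjc (z w : R[i]) : complex.Re (z * conjc w) =
  complex.Re z * complex.Re w + complex.Im z * complex.Im w.
Proof. by case: z w => [a b] [c d] /=; ring. Qed.

Lemma Im_mul_conjc (z w : R[i]) : complex.Im (z * conjc w) =
  complex.Im z * complex.Re w - complex.Re z * complex.Im w.
Proof. by case: z w => [a b] [c d] /=; ring. Qed.

Lemma Re_mulC (z : R[i]) (a : R) : complex.Re (z * a%:C%C) = complex.Re z * a.
Proof. by case: z => u v /=; rewrite mulr0 subr0. Qed.

Lemma Im_mulC (z : R[i]) (a : R) : complex.Im (z * a%:C%C) = complex.Im z * a.
Proof. by case: z => u v /=; rewrite mulr0 add0r. Qed.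

Lemma signC (k : nat) : (-1) ^+ k = ((-1) ^+ k)%:C%C :> R[i].
Proof. by rewrite rmorphXn rmorphN1. Qed.

Lemma test_function_derive1 (phi : R -> R) : test_function phi ->
  test_function (derive1 phi).
Proof.
move=> [dphi cphi]; split=> [n t|].
  by have := dphi n.+1 t; rewrite /derive1n iterSr.
apply: (subclosed_compact _ cphi); first exact: closed_closure.
have cK := closure_id (closure [set t | phi t != 0]).
rewrite [X in _ `<=` X](cK.1 (@closed_closure _ _)); apply: closureS => t.
apply: contraPP => /= nt; apply/negP; rewrite negbK.
have : nbhs t (~` closure [set t | phi t != 0]).
  by apply: open_nbhs_nbhs; split=> //; exact/closed_openC/closed_closure.
move=> nbt; rewrite derive1E -(near_eq_derive (f := cst (0 : R))) ?derive_cst//.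
apply: filterS nbt => z /= nz; apply/esym/eqP/negPn/negP => pz.
by apply: nz; exact: subset_closure.
Qed.

(** The real and the imaginary part are treated at once: [part] is one of them,
    and the hypotheses are what they have in common. *)
Section WeightedDerivatives.
Variables (N : nat) (psi : R -> R[i]) (part : R[i] -> R).
Hypotheses (partM : forall z (a : R), part (z * a%:C%C) = part z * a)
  (part_cint : forall h, part (cintegral h) = \int[mu]_t part (h t))
  (part_loc : forall h, clocally_integrable h -> locally_integrable setT (part \o h))
  (part_L2 : forall h, csquare_integrable h -> square_integrable (part \o h)).

Lemma weak_derivative_part k (g : R -> R[i]) phi : weak_derivative k psi g ->
  test_function phi -> \int[mu]_t (part (psi t) * derive1n k phi t) =
  (-1) ^+ k * \int[mu]_t (part (g t) * phi t).
Proof.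
move=> [_ _ wd] tphi; have /(congr1 part) := wd phi tphi.
rewrite signC [_%:C%C * _]mulrC partM !part_cint mulrC.
rewrite (eq_Rintegral mu (g := fun t => part (psi t) * derive1n k phi t)); last first.
  by move=> t _; exact: partM.
by move=> ->; congr (_ * _); apply: eq_Rintegral => t _; exact: partM.
Qed.

(** The k-th weak derivatives are all taken from psi. Testing the identity of
    order k on phi' and comparing it with that of order k + 1 shows that each is
    the first weak derivative of the preceding one. *)
Lemma weighted_derivatives_representative : (1 < N)%N ->
  weighted_derivatives_L2 N psi -> exists F : nat -> R -> R,
  [/\ {ae mu, forall t, part (psi t) = F 0%N t},
      forall k, (k < N)%N -> decays N (F k) &
      forall k (t : R), (k.+1 < N)%N -> is_derive t 1 (F k) (F k.+1 t)].
Proof.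
move=> N1 wpsi.
have /choice[g hg] : forall k, exists g : R -> R[i],
    (k <= N)%N -> weak_derivative k psi g /\
    forall l, (l <= N)%N -> csquare_integrable (time_weight l g).
  move=> k; have [kN|kN] := leqP k N; last by exists psi.
  by have [g g1 g2] := wpsi k kN; exists g.
pose p k t := part (g k t).
have locg k : (k <= N)%N -> locally_integrable setT (p k).
  by move=> kN; have [[_ lg _] _] := hg k kN; exact: part_loc lg.
have wd k phi (kN : (k <= N)%N) := @weak_derivative_part k (g k) phi (hg k kN).1.
have [F [F1 F2 F3 F4]] : exists F : nat -> R -> R,
  [/\ {ae mu, forall t, part (psi t) = F 0%N t},
      forall k, (k < N)%N -> continuous (F k),
      forall k, (k < N)%N -> exists C : R, forall t, weight N t * `|F k t| <= C &
      forall k (t : R), (k.+1 < N)%N -> is_derive t 1 (F k) (F k.+1 t)].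
  apply: (@smooth_representative _ N _ p) => //.
  - by have [[lp _ _] _] := hg 0%N (leq0n _); exact: part_loc lp.
  - by move=> phi tphi; have := wd 0%N phi (leq0n _) tphi; rewrite expr0 mul1r.
  - move=> k kN; have [_ l2] := hg k kN; split; first by have [] := locg k kN.
    move=> l lN; have [_] := part_L2 (l2 l lN).
    rewrite (_ : (fun t => (part \o time_weight l (g k)) t ^+ 2) =
      (fun t => (t ^+ l * p k t) ^+ 2))//.
    by apply/funext => t /=; rewrite /time_weight mulrC partM mulrC.
  - move=> k kN phi tphi.
    have e1 := wd k _ (ltnW kN) (test_function_derive1 tphi).
    have e2 := wd k.+1 phi kN tphi.
    rewrite (_ : derive1n k (derive1 phi) = derive1n k.+1 phi) in e1; last first.
      by rewrite /derive1n iterSr.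
    move: e2; rewrite e1 exprS mulN1r mulNr -mulrN.
    by apply: mulfI; rewrite signr_eq0.
by exists F; split=> // k kN; split; [exact: F2|exact: F3].
Qed.

End WeightedDerivatives.

(** The identities hold for y <= 0 as well, since the square root, and hence the
    normalising factor, is then 0. *)
Lemma wavelet_parts psi s P Q x y : csquare_integrable psi -> csquare_integrable s ->
  {ae mu, forall t, complex.Re (psi t) = P t} ->
  {ae mu, forall t, complex.Im (psi t) = Q t} -> decays 1 P -> decays 1 Q ->
  complex.Re (wavelet psi s (x, y)) = lincomb 1 1
    (transform (fun t => complex.Re (s t)) P) (transform (fun t => complex.Im (s t)) Q) x y
  /\ complex.Im (wavelet psi s (x, y)) = lincomb 1 (-1)
    (transform (fun t => complex.Im (s t)) P) (transform (fun t => complex.Re (s t)) Q) x y.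
Proof.
move=> hpsi hs pP qQ dP dQ.
have [[mp _] [mq _]] := csquare_integrable_parts hpsi.
have [sr si] := csquare_integrable_parts hs.
have [[mr _] [mi _]] := (sr, si).
rewrite /wavelet /= !mul0r subr0 addr0 /lincomb /transform.
have [y0|y0] := leP y 0; first by rewrite ler0_sqrtr// invr0 !mul0r !mulr0 addr0.
have comp (f : R -> R) : measurable_fun setT f ->
    measurable_fun setT (fun t => f ((t - x) / y)).
  by move=> mf; apply: measurableT_comp mf _; exact: measurable_affine.
have mp' := comp _ mp; have mq' := comp _ mq.
have mP := comp _ (continuous_measurable_fun dP.1).
have mQ := comp _ (continuous_measurable_fun dQ.1).
have iPr := integrable_correlation x sr dP y0;
  have iQi := integrable_correlation x si dQ y0.
have iPi := integrable_correlation x si dP y0;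
  have iQr := integrable_correlation x sr dQ y0.
have apP := ae_affine x y0 pP; have aqQ := ae_affine x y0 qQ.
split.
- rewrite !mul1r -mulrDr; congr (_ * _); rewrite /correlation -RintegralD//.
  transitivity (\int[mu]_t (complex.Re (s t) * complex.Re (psi ((t - x) / y)) +
      complex.Im (s t) * complex.Im (psi ((t - x) / y)))).
    by apply: eq_Rintegral => t _; exact: Re_mul_conjc.
  apply: Rintegral_ae => //.
  + by apply: measurable_funD; apply: measurable_funM.
  + by apply: measurable_funD; apply: measurable_funM.
  + apply: filterS2 apP aqQ; first exact: (ae_filter_ringOfSetsType mu).
    by move=> t -> ->.
- rewrite mul1r mulN1r -mulrN -mulrDr; congr (_ * _); rewrite /correlation -RintegralB//.
  transitivity (\int[mu]_t (complex.Im (s t) * complex.Re (psi ((t - x) / y)) -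
      complex.Re (s t) * complex.Im (psi ((t - x) / y)))).
    by apply: eq_Rintegral => t _; exact: Im_mul_conjc.
  apply: Rintegral_ae => //.
  + by apply: measurable_funB; apply: measurable_funM.
  + by apply: measurable_funB; apply: measurable_funM.
  + apply: filterS2 apP aqQ; first exact: (ae_filter_ringOfSetsType mu).
    by move=> t -> ->.
Qed.

Lemma wavelet_smooth N psi s : (1 < N)%N -> csquare_integrable psi ->
  csquare_integrable s -> weighted_derivatives_L2 N psi ->
  exists ux uy vx vy,
  [/\ C1_half_plane (fun x y => complex.Re (wavelet psi s (x, y))) ux uy,
      C1_half_plane (fun x y => complex.Im (wavelet psi s (x, y))) vx vy &
      (2 < N)%N -> (exists uxx uyy, C2_on_lines ux uy uxx uyy) /\
        (exists vxx vyy, C2_on_lines vx vy vxx vyy)].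
Proof.
move=> N1 hpsi hs wpsi.
have [P [P0 dP dP']] := weighted_derivatives_representative Re_mulC
  (fun h => erefl) (fun h hl => hl.1) (fun h hl => (csquare_integrable_parts hl).1) N1 wpsi.
have [Q [Q0 dQ dQ']] := weighted_derivatives_representative Im_mulC
  (fun h => erefl) (fun h hl => hl.2) (fun h hl => (csquare_integrable_parts hl).2) N1 wpsi.
have [sr si] := csquare_integrable_parts hs.
have N0 := ltnW N1.
have E x y := wavelet_parts x y hpsi hs P0 Q0 (decaysW N0 (dP _ N0)) (decaysW N0 (dQ _ N0)).
have C1 (s' : R -> R) (F : nat -> R -> R) : square_integrable s' ->
    (forall k, (k < N)%N -> decays N (F k)) ->
    (forall k (t : R), (k.+1 < N)%N -> is_derive t 1 (F k) (F k.+1 t)) ->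
    C1_half_plane (transform s' (F 0%N)) (transform_x s' (F 1%N)) (transform_y s' (F 0%N) (F 1%N)).
  move=> ss' dF F'; apply: C1_transform => //.
  - exact: decaysW (dF _ N0).
  - exact: decaysW (dF _ N1).
  - by move=> t; exact: F'.
have C2 (s' : R -> R) (F : nat -> R -> R) : (2 < N)%N ->
    square_integrable s' -> (forall k, (k < N)%N -> decays N (F k)) ->
    (forall k (t : R), (k.+1 < N)%N -> is_derive t 1 (F k) (F k.+1 t)) ->
    exists uxx uyy, C2_on_lines (transform_x s' (F 1%N)) (transform_y s' (F 0%N) (F 1%N)) uxx uyy.
  move=> N2 ss' dF F'; apply: (@C2_transform _ s' (F 0%N) (F 1%N) (F 2%N)) => //.
  - exact: decaysW (dF _ N0).
  - exact: decaysW (dF _ N1).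
  - exact: decaysW (dF _ N2).
  - by move=> t; exact: F'.
  - by move=> t; exact: F'.
have -> : (fun x y => complex.Re (wavelet psi s (x, y))) = lincomb 1 1
    (transform (fun t => complex.Re (s t)) (P 0%N)) (transform (fun t => complex.Im (s t)) (Q 0%N)).
  by apply/funext => x; apply/funext => y; have [] := E x y.
have -> : (fun x y => complex.Im (wavelet psi s (x, y))) = lincomb 1 (-1)
    (transform (fun t => complex.Im (s t)) (P 0%N)) (transform (fun t => complex.Re (s t)) (Q 0%N)).
  by apply/funext => x; apply/funext => y; have [] := E x y.
do 4 eexists; split.
- exact: C1_lincomb (C1 _ _ sr dP dP') (C1 _ _ si dQ dQ').
- exact: C1_lincomb (C1 _ _ si dP dP') (C1 _ _ sr dQ dQ').
- move=> N2.
  have [a1 [a2 ha]] := C2 _ _ N2 sr dP dP'; have [b1 [b2 hb]] := C2 _ _ N2 si dQ dQ'.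
  have [c1 [c2 hc]] := C2 _ _ N2 si dP dP'; have [d1 [d2 hd]] := C2 _ _ N2 sr dQ dQ'.
  split; do 2 eexists; [exact: C2_lincomb ha hb|exact: C2_lincomb hc hd].
Qed.

End Representative.
(** * Branches of the phase *)
Section Phase.
Context {R : realType}.
Implicit Types (W : R * R -> R[i]) (p q : R * R) (theta : R * R -> R).

Lemma unit_circle_angle (a b : R) : a ^+ 2 + b ^+ 2 = 1 ->
  exists th, cos th = a /\ sin th = b.
Proof.
move=> ab; have a1 : -1 <= a <= 1.
  by apply/andP; split; have := sqr_ge0 b; nra.
have bE : b ^+ 2 = 1 - a ^+ 2 by rewrite -ab; ring.
have cK : cos (acos a) = a by apply: acosK; rewrite in_itv.
have [b0|b0] := leP 0 b.
  by exists (acos a); split => //; rewrite sin_acos// -bE sqrtr_sqr ger0_norm.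
exists (- acos a); split; first by rewrite cosN.
by rewrite sinN sin_acos// -bE sqrtr_sqr ltr0_norm// opprK.
Qed.

(** The imaginary part of W q times the conjugate of W p, that is
    |W p| * |W q| times the sine of the phase difference; [inner] is the real
    part, with the cosine. *)
Definition cross W p q :=
  complex.Im (W q) * complex.Re (W p) - complex.Re (W q) * complex.Im (W p).

Definition inner W p q :=
  complex.Re (W q) * complex.Re (W p) + complex.Im (W q) * complex.Im (W p).

Definition modulus_sq W p := complex.Re (W p) ^+ 2 + complex.Im (W p) ^+ 2.

Lemma cross_inner W p q : cross W p q ^+ 2 + inner W p q ^+ 2 =
  modulus_sq W p * modulus_sq W q.
Proof. by rewrite /cross /inner /modulus_sq; ring. Qed.

Lemma modulus_sq_eq0 W p : (modulus_sq W p == 0) = (W p == 0).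
Proof.
rewrite /modulus_sq paddr_eq0 ?sqr_ge0// !sqrf_eq0.
by case: (W p) => a b; rewrite eq_complex.
Qed.

Lemma modulus_sq_gt0 W p : W p != 0 -> 0 < modulus_sq W p.
Proof. by rewrite -modulus_sq_eq0 lt0r => ->; rewrite /modulus_sq addr_ge0// sqr_ge0. Qed.

Lemma polarE (z : R[i]) (th : R) :
  z = (Normc.normc z)%:C%C * (cos th +i* sin th)%C <->
  complex.Re z = Num.sqrt (complex.Re z ^+ 2 + complex.Im z ^+ 2) * cos th /\
  complex.Im z = Num.sqrt (complex.Re z ^+ 2 + complex.Im z ^+ 2) * sin th.
Proof.
case: z => a b /=; split.
  by case; rewrite !mul0r subr0 addr0.
by move=> [ha hb]; rewrite /= /GRing.mul/= !mul0r subr0 addr0 -ha -hb.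
Qed.

Definition continuous_parts W q :=
  {for q, continuous (fun q => complex.Re (W q))} /\
  {for q, continuous (fun q => complex.Im (W q))}.

Lemma continuous_cross W p q : continuous_parts W q -> {for q, continuous (cross W p)}.
Proof. by move=> [cr ci]; apply: cvgB; apply: cvgM => //; exact: cvg_cst. Qed.

Lemma continuous_inner W p q : continuous_parts W q -> {for q, continuous (inner W p)}.
Proof. by move=> [cr ci]; apply: cvgD; apply: cvgM => //; exact: cvg_cst. Qed.

Lemma innerpp W p : inner W p p = modulus_sq W p.
Proof. by rewrite /inner /modulus_sq !expr2. Qed.

Lemma crosspp W p : cross W p p = 0.
Proof. by rewrite /cross mulrC subrr. Qed.

Lemma inner_gt0_near W p : W p != 0 -> continuous_parts W p ->
  \forall q \near p, 0 < inner W p q.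
Proof.
move=> W0 cW; have := continuous_inner (p := p) cW.
rewrite /prop_for /continuous_at innerpp => c.
have h := @cvgr_gt R _ (nbhs p) _ (inner W p) _ c; apply: h.
exact: modulus_sq_gt0.
Qed.

Lemma sin_atan (u : R) : sin (atan u) = u * (Num.sqrt (1 + u ^+ 2))^-1.
Proof.
rewrite -cos_atan -{2}(atanK u) /tan divfK//.
by rewrite cos_atan invr_eq0 gt_eqF// sqrtr_gt0 ltr_pwDl// sqr_ge0.
Qed.

Lemma sqrt_one_plus (a b : R) : 0 < b ->
  Num.sqrt (1 + (a / b) ^+ 2) = Num.sqrt (a ^+ 2 + b ^+ 2) / b.
Proof.
move=> b0; have -> : 1 + (a / b) ^+ 2 = (a ^+ 2 + b ^+ 2) * b^-1 ^+ 2.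
  by field; rewrite gt_eqF.
by rewrite sqrtrM ?addr_ge0 ?sqr_ge0// sqrtr_sqr gtr0_norm// invr_gt0.
Qed.

(** Where W q stays in the open half plane around W p, its angle to W p is the
    arctangent of [cross / inner]; add a fixed argument of W p. *)
Lemma phase_branch_exists W p : W p != 0 ->
  (\forall q \near p, continuous_parts W q) -> exists theta, phase_branch W p theta.
Proof.
move=> W0 cW; have m0 := modulus_sq_gt0 W0; set m := modulus_sq W p in m0.
have sm0 : 0 < Num.sqrt m by rewrite sqrtr_gt0.
have [th0 [c0 s0]] : exists th, cos th = complex.Re (W p) / Num.sqrt m /\
    sin th = complex.Im (W p) / Num.sqrt m.
  apply: unit_circle_angle; rewrite !expr_div_n sqr_sqrtr ?ltW// -mulrDl divff// gt_eqF//.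
exists (fun q => th0 + atan (cross W p q / inner W p q)).
have ig := inner_gt0_near W0 (nbhs_singleton cW).
near=> q; have cWq : continuous_parts W q by near: q.
have iq : 0 < inner W p q by near: q.
have Aq := cross_inner W p q; rewrite -/m in Aq.
have mq0 : 0 < modulus_sq W q.
  by rewrite -(pmulr_rgt0 _ m0) -Aq ltr_wpDl ?sqr_ge0// exprn_gt0.
split.
  apply: cvgD; first exact: cvg_cst.
  apply: (continuous_comp (f := fun q => cross W p q / inner W p q) (g := @atan R)).
    apply: cvgM; first exact: continuous_cross.
    by apply: cvgV; [rewrite gt_eqF|exact: continuous_inner].
  exact: continuous_atan.
apply/polarE; rewrite -/(modulus_sq W q).
rewrite cosD sinD cos_atan sin_atan sqrt_one_plus// Aq sqrtrM ?ltW// c0 s0.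
have sq0 : 0 < Num.sqrt (modulus_sq W q) by rewrite sqrtr_gt0.
have mE : Num.sqrt m ^+ 2 = m by rewrite sqr_sqrtr// ltW.
have key a b : (a * inner W p q - b * cross W p q) / Num.sqrt m ^+ 2 =
  Num.sqrt (modulus_sq W q) *
  (a / Num.sqrt m * (Num.sqrt m * Num.sqrt (modulus_sq W q) / inner W p q)^-1 -
   b / Num.sqrt m * (cross W p q / inner W p q *
     (Num.sqrt m * Num.sqrt (modulus_sq W q) / inner W p q)^-1)).
  by field; rewrite !gt_eqF.
split.
- rewrite -key mE; apply: (mulIf (lt0r_neq0 m0)); rewrite divfK ?gt_eqF//.
  by rewrite /m /modulus_sq /inner /cross; ring.
- transitivity ((complex.Im (W p) * inner W p q + complex.Re (W p) * cross W p q) /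
    Num.sqrt m ^+ 2).
    rewrite mE; apply: (mulIf (lt0r_neq0 m0)); rewrite divfK ?gt_eqF//.
    by rewrite /m /modulus_sq /inner /cross; ring.
  by field; rewrite !gt_eqF.
Unshelve. all: by end_near. Qed.

(** A continuous branch differs from its value at p by less than pi / 2 near p,
    and on that range the arctangent inverts the tangent. Hence all branches have
    the same derivatives. *)
Lemma phase_branch_near W p theta : W p != 0 -> continuous_parts W p ->
  phase_branch W p theta ->
  \forall q \near p, theta q = theta p + atan (cross W p q / inner W p q).
Proof.
move=> W0 cW br; have [cth polp] := nbhs_singleton br.
have pi2 : 0 < pi / 2 :> R by rewrite divr_gt0 ?pi_gt0.
have ig := inner_gt0_near W0 cW.
have dn : \forall q \near p, `|theta p - theta q| < pi / 2.
  by move/cvgrPdist_lt : cth; exact.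
near=> q; have iq : 0 < inner W p q by near: q.
have [_ polq] : {for q, continuous theta} /\
    W q = (Normc.normc (W q))%:C%C * (cos (theta q) +i* sin (theta q))%C by near: q.
have dq : `|theta p - theta q| < pi / 2 by near: q.
set d := theta q - theta p.
have dE : theta q = theta p + d by rewrite /d; ring.
have di : d \in `](- (pi / 2)), (pi / 2)[.
  by rewrite in_itv/= -ltr_norml /d distrC.
rewrite dE; congr (_ + _); rewrite -[LHS](tanK di); congr atan.
move/polarE: polp => [rp ip]; move/polarE: polq => [rq iq'].
rewrite -/(modulus_sq W p) in rp ip; rewrite -/(modulus_sq W q) in rq iq'.
have Ap : cross W p q = Num.sqrt (modulus_sq W p) * Num.sqrt (modulus_sq W q) * sin d.
  by rewrite /cross rp ip rq iq' /d sinB; ring.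
have Bp : inner W p q = Num.sqrt (modulus_sq W p) * Num.sqrt (modulus_sq W q) * cos d.
  by rewrite /inner rp ip rq iq' /d cosB; ring.
have c0 : 0 < cos d by apply: cos_gt0_pihalf; move: di; rewrite in_itv.
have ss0 : Num.sqrt (modulus_sq W p) * Num.sqrt (modulus_sq W q) != 0.
  by apply: contraTneq iq => h; rewrite Bp h mul0r ltxx.
by rewrite Ap Bp /tan -mulf_div divff// mul1r.
Unshelve. all: by end_near. Qed.

Lemma phase_branch_derive W p theta (c : R -> R * R) (t0 u' v' : R) :
  c t0 = p -> {for t0, continuous c} -> W p != 0 -> continuous_parts W p ->
  phase_branch W p theta ->
  is_derive t0 1 (fun t => complex.Re (W (c t))) u' ->
  is_derive t0 1 (fun t => complex.Im (W (c t))) v' ->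
  is_derive t0 1 (fun t => theta (c t))
    ((complex.Re (W p) * v' - complex.Im (W p) * u') / modulus_sq W p).
Proof.
move=> cp cc W0 cW br du dv; have m0 := modulus_sq_gt0 W0.
have near_eq := phase_branch_near W0 cW br.
pose A t := cross W p (c t); pose B t := inner W p (c t).
have dA : is_derive t0 1 A (complex.Re (W p) * v' - complex.Im (W p) * u').
  have h := is_deriveB (is_deriveZ (complex.Re (W p)) dv) (is_deriveZ (complex.Im (W p)) du).
  rewrite (_ : A = (fun t => complex.Re (W p) *: complex.Im (W (c t))) \-
    (fun t => complex.Im (W p) *: complex.Re (W (c t)))).
    exact: (is_derive_eq h).
  by apply/funext => t; rewrite /A /cross /GRing.scale/=; ring.
have dB : is_derive t0 1 B (complex.Re (W p) * u' + complex.Im (W p) * v').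
  have h := is_deriveD (is_deriveZ (complex.Re (W p)) du) (is_deriveZ (complex.Im (W p)) dv).
  rewrite (_ : B = (fun t => complex.Re (W p) *: complex.Re (W (c t))) \+
    (fun t => complex.Im (W p) *: complex.Im (W (c t)))).
    exact: (is_derive_eq h).
  by apply/funext => t; rewrite /B /inner /GRing.scale/=; ring.
have A0 : A t0 = 0 by rewrite /A cp crosspp.
have B0 : B t0 = modulus_sq W p by rewrite /B cp innerpp.
have Bn0 : B t0 != 0 by rewrite B0 gt_eqF.
have dAB := is_deriveM dA (is_deriveV Bn0 dB).
have dat := @is_derive1_comp R atan (fun t => A t * (B t)^-1) t0 _ _ (is_derive1_atan _) dAB.
have dth := is_deriveD (is_derive_cst (theta p) t0 1) dat.
have {}dth : is_derive t0 1 (fun t => theta p + atan (A t / B t))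
    ((complex.Re (W p) * v' - complex.Im (W p) * u') / modulus_sq W p).
  apply: (is_derive_eq dth);
    rewrite A0 B0 /GRing.scale/= !mul0r expr0n/= addr0 invr1 !add0r mul1r.
  by rewrite mulrC.
apply: near_eq_is_derive dth.
have near_c : \forall t \near t0, theta (c t) = theta p + atan (cross W p (c t) / inner W p (c t)).
  have nq : nbhs (c t0) [set q | theta q = theta p + atan (cross W p q / inner W p q)].
    by rewrite cp; exact: near_eq.
  exact: (cc _ nq).
by apply: filterS near_c => t ->.
Qed.

Lemma phase_derivative W p (c : R -> R * R) (t0 u' v' : R) :
  c t0 = p -> {for t0, continuous c} -> W p != 0 ->
  (\forall q \near p, continuous_parts W q) ->
  is_derive t0 1 (fun t => complex.Re (W (c t))) u' ->
  is_derive t0 1 (fun t => complex.Im (W (c t))) v' ->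
  [/\ W p != 0, exists theta, phase_branch W p theta &
    forall theta, phase_branch W p theta -> is_derive t0 1 (fun t => theta (c t))
      ((complex.Re (W p) * v' - complex.Im (W p) * u') / modulus_sq W p)].
Proof.
move=> cp cc W0 cW du dv; split=> //; first exact: phase_branch_exists.
move=> theta br; apply: (phase_branch_derive cp cc W0 _ br du dv).
exact: nbhs_singleton cW.
Qed.

End Phase.

(** * The rotation rate near a zero *)
Section Limits.
Context {R : realType}.
Implicit Types (f g p q : R -> R) (c t e : R).

Lemma cvg_line_dnbhs c (sg : R) : sg != 0 -> (c + sg * e) @[e --> 0^'+] --> c^'.
Proof.
move=> sg0 A; rewrite /dnbhs /within /= => -[d /= d0 dA].
have sgn0 : 0 < `|sg| by rewrite normr_gt0.
exists (d / `|sg|) => /=; first by rewrite divr_gt0.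
move=> e /=; rewrite sub0r normrN => ed e0; apply: dA => /=.
  by rewrite opprD addNKr normrN normrM -ltr_pdivlMl// mulrC.
by rewrite addrC -subr_eq0 addrK mulf_neq0// gt_eqF.
Qed.

Lemma difference_quotient_cvg f c (f1 : R) : f c = 0 -> is_derive c 1 f f1 ->
  f t / (t - c) @[t --> c^'] --> f1.
Proof.
move=> fc0 /is_derive1_caratheodory[g [gE cg g1]].
have gc : g t @[t --> c^'] --> g c by exact/continuous_withinNx.
rewrite -g1; apply: cvg_trans gc; apply: near_eq_cvg; near=> t.
have tc : t - c != 0.
  by rewrite subr_eq0; near: t; exact: nbhs_dnbhs_neq.
by rewrite -[f t]subr0 -fc0 gE mulfK.
Unshelve. all: by end_near. Qed.

Lemma sum_sq_neq0_near f g c (f1 g1 : R) : f c = 0 -> g c = 0 ->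
  is_derive c 1 f f1 -> is_derive c 1 g g1 -> f1 ^+ 2 + g1 ^+ 2 != 0 ->
  \forall t \near c^', f t ^+ 2 + g t ^+ 2 != 0.
Proof.
move=> fc gc df dg n0.
have qf := difference_quotient_cvg fc df; have qg := difference_quotient_cvg gc dg.
have q2 : ((f t / (t - c)) ^+ 2 + (g t / (t - c)) ^+ 2) @[t --> c^'] --> f1 ^+ 2 + g1 ^+ 2.
  by apply: cvgD; apply: cvgM.
have pos : 0 < f1 ^+ 2 + g1 ^+ 2 by rewrite lt0r n0 addr_ge0 ?sqr_ge0.
have q3 := @cvgr_gt R _ _ _ _ _ q2 _ pos; near=> t.
have : 0 < (f t / (t - c)) ^+ 2 + (g t / (t - c)) ^+ 2 by near: t; exact: q3.
apply: contraTneq => ft.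
by rewrite !expr_div_n -mulrDl ft mul0r ltxx.
Unshelve. all: by end_near. Qed.

(** Divide numerator and denominator by (t - c) ^ 2. *)
Lemma rotation_rate_pole f g p q c (f1 g1 : R) : f c = 0 -> g c = 0 ->
  is_derive c 1 f f1 -> is_derive c 1 g g1 -> {for c, continuous p} ->
  {for c, continuous q} -> f1 ^+ 2 + g1 ^+ 2 != 0 ->
  (f t * q t - g t * p t) / (f t ^+ 2 + g t ^+ 2) * (t - c) @[t --> c^'] -->
    (f1 * q c - g1 * p c) / (f1 ^+ 2 + g1 ^+ 2).
Proof.
move=> fc gc df dg cp cq n0.
have qf := difference_quotient_cvg fc df; have qg := difference_quotient_cvg gc dg.
have cp' : p t @[t --> c^'] --> p c by exact/continuous_withinNx.
have cq' : q t @[t --> c^'] --> q c by exact/continuous_withinNx.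
have lim : ((f t / (t - c)) * q t - (g t / (t - c)) * p t) /
    ((f t / (t - c)) ^+ 2 + (g t / (t - c)) ^+ 2) @[t --> c^'] -->
    (f1 * q c - g1 * p c) / (f1 ^+ 2 + g1 ^+ 2).
  apply: cvgM; first by apply: cvgB; apply: cvgM.
  by apply: cvgV => //; apply: cvgD; apply: cvgM.
apply: cvg_trans lim; apply: near_eq_cvg; near=> t.
have tc : t - c != 0.
  by rewrite subr_eq0; near: t; exact: nbhs_dnbhs_neq.
have s0 : f t ^+ 2 + g t ^+ 2 != 0 by near: t; exact: sum_sq_neq0_near n0.
have s1 : (f t / (t - c)) ^+ 2 + (g t / (t - c)) ^+ 2 != 0.
  by rewrite !expr_div_n -mulrDl mulf_neq0// invr_eq0 expf_neq0.
rewrite !expr_div_n -mulrDl; field; exact/andP.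
Unshelve. all: by end_near. Qed.

(** The sign [sg] selects the side from which c is approached. *)
Lemma pole_blowup (h : R -> R) c (L sg : R) : (sg = 1) \/ (sg = -1) -> L != 0 ->
  h t * (t - c) @[t --> c^'] --> L ->
  (h (c + sg * e))%:E @[e --> 0^'+] --> (if (0 < sg * L)%R then +oo else -oo)%E.
Proof.
move=> sg1 L0 hL; have sgn0 : sg != 0 by case: sg1 => ->; rewrite ?oppr_eq0 oner_neq0.
have sgL0 : sg * L != 0 by rewrite mulf_neq0.
have sg2 : sg * sg = 1 by case: sg1 => ->; rewrite ?mulrNN mulr1.
have lim : (h (c + sg * e) * e) @[e --> 0^'+] --> sg * L.
  have lim := cvg_comp _ _ (cvg_line_dnbhs (c := c) sgn0) hL.
  have {}lim : sg * (h (c + sg * e) * (c + sg * e - c)) @[e --> 0^'+] --> sg * L.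
    by apply: cvgM; [exact: cvg_cst|exact: lim].
  apply: cvg_trans lim; apply: near_eq_cvg; near=> e.
  transitivity (h (c + sg * e) * (sg * sg * e)); first by ring.
  by rewrite sg2 mul1r.
have [pos|neg] := ltP 0 (sg * L).
  apply/cvgeryP/cvgryPger => A _.
  have L2 : sg * L / 2 < sg * L by lra.
  have ge2 : \forall e \near 0^'+, sg * L / 2 < h (c + sg * e) * e.
    exact: (@cvgr_gt R _ _ _ _ _ lim _ L2).
  have LA : 0 < sg * L / 2 / (`|A| + 1) by rewrite !divr_gt0// ltr_wpDl.
  near=> e; have e0 : 0 < e by [].
  rewrite -(ler_pM2r e0); apply: (@le_trans _ _ (sg * L / 2)); last by apply: ltW;
    near: e; exact: ge2.
  apply: (@le_trans _ _ ((`|A| + 1) * e)).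
    by rewrite ler_pM2r// (le_trans (ler_norm _))// lerDl.
  rewrite mulrC -ler_pdivlMr ?ltr_wpDl//; near: e; exact: nbhs_right_le.
have {}neg : sg * L < 0 by rewrite lt_neqAle sgL0.
apply/cvgerNyP/cvgrNyPler => A _.
have L2 : sg * L < sg * L / 2 by lra.
have le2 : \forall e \near 0^'+, h (c + sg * e) * e < sg * L / 2.
  exact: (@cvgr_lt R _ _ _ _ _ lim _ L2).
have LA : 0 < - (sg * L / 2) / (`|A| + 1) by rewrite divr_gt0 ?ltr_wpDl//; lra.
near=> e; have e0 : 0 < e by [].
rewrite -(ler_pM2r e0); apply: (@le_trans _ _ (sg * L / 2)); first by apply: ltW;
  near: e; exact: le2.
apply: (@le_trans _ _ (- ((`|A| + 1) * e))); last first.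
  by rewrite -mulNr ler_pM2r// lerNl (le_trans _ (_ : `|A| <= _)) ?lerDl// -normrN ler_norm.
rewrite lerNr mulrC -ler_pdivlMr ?ltr_wpDl//; near: e; exact: nbhs_right_le.
Unshelve. all: by end_near. Qed.

(** The numerator K = f g' - g f' vanishes at c with K' = f g'' - g f'', in
    which the products f' g' have cancelled. By L'Hopital, K / (t - c) ^ 2 has
    the same limit as K' / (2 (t - c)), a combination of the difference quotients
    of f and g. *)
Lemma rotation_rate_inflection (f f' f'' g g' g'' : R -> R) c :
  (\forall t \near c, [/\ is_derive (t : R) 1 f (f' t),
     is_derive (t : R) 1 f' (f'' t), is_derive (t : R) 1 g (g' t) &
     is_derive (t : R) 1 g' (g'' t)]) ->
  {for c, continuous f''} -> {for c, continuous g''} ->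
  f c = 0 -> g c = 0 -> f' c ^+ 2 + g' c ^+ 2 != 0 ->
  (f t * g' t - g t * f' t) / (f t ^+ 2 + g t ^+ 2) @[t --> c^'] -->
    (f' c * g'' c - g' c * f'' c) / 2 / (f' c ^+ 2 + g' c ^+ 2).
Proof.
move=> der cf cg fc gc n0.
have [df df' dg dg'] := nbhs_singleton der.
have qf := difference_quotient_cvg fc df; have qg := difference_quotient_cvg gc dg.
have cf' : f'' t @[t --> c^'] --> f'' c by exact/continuous_withinNx.
have cg' : g'' t @[t --> c^'] --> g'' c by exact/continuous_withinNx.
pose K t := f t * g' t - g t * f' t; pose K' t := f t * g'' t - g t * f'' t.
pose S t := (t - c) ^+ 2; pose S' t := 2 * (t - c).
set l := (f' c * g'' c - g' c * f'' c) / 2.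
have KS' : K' t / S' t @[t --> c^'] --> l.
  have lim : (f t / (t - c) * g'' t - g t / (t - c) * f'' t) / 2 @[t --> c^'] --> l.
    by apply: cvgM; [apply: cvgB; exact: cvgM|exact: cvg_cst].
  apply: cvg_trans lim; apply: near_eq_cvg; near=> t.
  have tc : t - c != 0.
    by rewrite subr_eq0; near: t; exact: nbhs_dnbhs_neq.
  by rewrite /K' /S'; field.
have KK' : \forall t \near c, is_derive (t : R) 1 K (K' t).
  apply: filterS der => t [dft dft' dgt dgt'].
  have h := is_deriveB (is_deriveM dft dgt') (is_deriveM dgt dft').
  by apply: (is_derive_eq h); rewrite /K' /GRing.scale/=; ring.
have SS' t : is_derive t 1 S (S' t).
  have h1 := is_deriveB (is_derive_id t 1) (is_derive_cst c t 1).
  have h := is_deriveM h1 h1; rewrite (_ : S = (id \- cst c) * (id \- cst c)).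
    by apply: (is_derive_eq h); rewrite /S' /GRing.scale/= !fctE subr0 !mulr1; ring.
  by apply/funext => u; rewrite /S !fctE expr2.
have K0 : K t @[t --> c] --> 0.
  have [dK _] := nbhs_singleton KK'.
  have : {for c, continuous K} by exact/differentiable_continuous/derivable1_diffP.
  by rewrite /prop_for /continuous_at /K fc gc !mul0r subr0.
have S0 : S t @[t --> c] --> 0.
  have [dS _] := SS' c.
  have : {for c, continuous S} by exact/differentiable_continuous/derivable1_diffP.
  by rewrite /prop_for /continuous_at /S subrr expr0n.
have [r /= r0 hr] := KK'.
have KS : K t / S t @[t --> c^'] --> l.
  apply/(@cvg_at_right_left_dnbhs _ R^o).
  - apply: (@lhopital_at_right R K K' S S' c (c + r)).
    + by rewrite ltrDl.
    + by move=> t; rewrite in_itv/= => /andP[t1 t2]; apply: hr;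
      rewrite /ball_/= ltr_norml; apply/andP; split; lra.
    + exact: cvg_at_right_filter.
    + exact: cvg_at_right_filter.
    + by move=> t; rewrite in_itv/= => /andP[t1 t2]; rewrite /S' mulf_neq0// gt_eqF//;
      lra.
    + exact: cvg_dnbhs_at_right.
  - apply: (@lhopital_at_left R K K' S S' (c - r) c).
    + by rewrite ltrBlDr ltrDl.
    + by move=> t; rewrite in_itv/= => /andP[t1 t2]; apply: hr;
      rewrite /ball_/= ltr_norml; apply/andP; split; lra.
    + exact: cvg_at_left_filter.
    + exact: cvg_at_left_filter.
    + by move=> t; rewrite in_itv/= => /andP[t1 t2]; rewrite /S' mulf_neq0// lt_eqF//;
      lra.
    + exact: cvg_dnbhs_at_left.
have lim : (K t / S t) / ((f t / (t - c)) ^+ 2 + (g t / (t - c)) ^+ 2) @[t --> c^'] -->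
    l / (f' c ^+ 2 + g' c ^+ 2).
  by apply: cvgM => //; apply: cvgV => //; apply: cvgD; apply: cvgM.
apply: cvg_trans lim; apply: near_eq_cvg; near=> t.
have tc : t - c != 0.
  by rewrite subr_eq0; near: t; exact: nbhs_dnbhs_neq.
have s0 : f t ^+ 2 + g t ^+ 2 != 0 by near: t; exact: sum_sq_neq0_near n0.
rewrite /K /S !expr_div_n -mulrDl; field; exact/andP.
Unshelve. all: by end_near. Qed.

End Limits.
(** * The phase derivatives at a zero of the transform *)
Section Main.
Context {R : realType}.
Implicit Types (W : R * R -> R[i]) (x y t e : R).

Lemma phase_lim_pole (D : R * R -> R -> Prop) (gamma path : R -> R * R)
    (rate : R -> R) (c L sg : R) :
  sg = 1 \/ sg = -1 -> L != 0 -> (forall e, gamma e = path (c + sg * e)) ->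
  (\forall t \near c^', D (path t) (rate t)) ->
  rate t * (t - c) @[t --> c^'] --> L ->
  phase_lim D gamma (if (0 < sg * L)%R then +oo else -oo)%E.
Proof.
move=> sg1 L0 gE nD hL; have sg0 : sg != 0.
  by case: sg1 => ->; rewrite ?oppr_eq0 oner_neq0.
exists (fun e => rate (c + sg * e)); last exact: pole_blowup sg1 L0 hL.
have := cvg_line_dnbhs (c := c) sg0 nD.
by move=> h; near=> e; rewrite gE; near: e; exact: h.
Unshelve. all: by end_near. Qed.

Lemma phase_lim_finite (D : R * R -> R -> Prop) (gamma path : R -> R * R)
    (rate : R -> R) (c l sg : R) :
  sg != 0 -> (forall e, gamma e = path (c + sg * e)) ->
  (\forall t \near c^', D (path t) (rate t)) ->
  rate t @[t --> c^'] --> l -> phase_lim D gamma l%:E.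
Proof.
move=> sg0 gE nD hl; exists (fun e => rate (c + sg * e)).
  have := cvg_line_dnbhs (c := c) sg0 nD.
  by move=> h; near=> e; rewrite gE; near: e; exact: h.
apply: cvg_EFin; first exact: nearW.
exact: cvg_comp (cvg_line_dnbhs (c := c) sg0) hl.
Unshelve. all: by end_near. Qed.

(** Both poles have residue of the sign of J or - J; multiplying by the sign of J
    removes this ambiguity. *)
Lemma sg_mul_infty (J : R) : J != 0 ->
  ((Num.sg J)%:E * (if (0 < J)%R then +oo else -oo) = +oo)%E /\
  ((Num.sg J)%:E * (if (0 < - J)%R then +oo else -oo) = -oo)%E.
Proof.
rewrite oppr_gt0 => J0; have [J1|J1|J1] := ltgtP 0 J.
- by rewrite gtr0_sg// !mul1e.
- by rewrite ltr0_sg// EFinN !mulN1e.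
- by rewrite -J1 eqxx in J0.
Qed.

Lemma continuous_horizontal x y : {for x, continuous (fun x => (x, y))}.
Proof.
move=> A [[B C] /= [Bx Cy] BCA]; apply: filterS Bx => t Bt; apply: BCA.
by split => //=; exact: nbhs_singleton Cy.
Qed.

Lemma continuous_vertical x y : {for y, continuous (fun y => (x, y))}.
Proof.
move=> A [[B C] /= [Bx Cy] BCA]; apply: filterS Cy => t Ct; apply: BCA.
by split => //=; exact: nbhs_singleton Bx.
Qed.

Section ZeroOfWavelet.
Variables (W : R * R -> R[i]) (ux uy vx vy : R -> R -> R) (x0 y0 : R).
Let U x y := complex.Re (W (x, y)).
Let V x y := complex.Im (W (x, y)).
Hypotheses (hU : C1_half_plane U ux uy) (hV : C1_half_plane V vx vy).
Hypotheses (y00 : 0 < y0) (W0 : W (x0, y0) = 0).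

Let rate_x x y := (U x y * vx x y - V x y * ux x y) / (U x y ^+ 2 + V x y ^+ 2).
Let rate_y x y := (U x y * vy x y - V x y * uy x y) / (U x y ^+ 2 + V x y ^+ 2).

Let U0 : U x0 y0 = 0. Proof. by rewrite /U W0. Qed.
Let V0 : V x0 y0 = 0. Proof. by rewrite /V W0. Qed.

Let continuous_parts_W x y : 0 < y -> \forall q \near (x, y), continuous_parts W q.
Proof.
move=> y1; have snd_gt0 : \forall q \near (x, y), 0 < q.2.
  have h : q.2 @[q --> (x, y)] --> y by exact: cvg_snd.
  exact: (@cvgr_gt R _ _ _ _ _ h _ y1).
apply: filterS snd_gt0 => -[x1 y1'] /= y1'0.
have [_ _ cU _ _] := hU x1 y1'0; have [_ _ cV _ _] := hV x1 y1'0.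
split.
- rewrite (_ : (fun q => complex.Re (W q)) = (fun p => U p.1 p.2))//.
  by apply/funext => -[].
- rewrite (_ : (fun q => complex.Im (W q)) = (fun p => V p.1 p.2))//.
  by apply/funext => -[].
Qed.

Let W_neq0 x y : U x y ^+ 2 + V x y ^+ 2 != 0 -> W (x, y) != 0.
Proof. by apply: contra => /eqP h; rewrite /U /V h /= expr0n/= addr0. Qed.

Let phase_dx_rate x y : 0 < y -> U x y ^+ 2 + V x y ^+ 2 != 0 ->
  phase_dx W (x, y) (rate_x x y).
Proof.
move=> y1 n0; have [dU _ _ _ _] := hU x y1; have [dV _ _ _ _] := hV x y1.
apply: (@phase_derivative _ W (x, y) (fun x => (x, y)) x) => //.
- exact: continuous_horizontal.
- exact: W_neq0.
- exact: continuous_parts_W.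
Qed.

Let phase_dy_rate x y : 0 < y -> U x y ^+ 2 + V x y ^+ 2 != 0 ->
  phase_dy W (x, y) (rate_y x y).
Proof.
move=> y1 n0; have [_ dU _ _ _] := hU x y1; have [_ dV _ _ _] := hV x y1.
apply: (@phase_derivative _ W (x, y) (fun y => (x, y)) y) => //.
- exact: continuous_vertical.
- exact: W_neq0.
- exact: continuous_parts_W.
Qed.

Lemma jacobian_detE : jacobian_det W (x0, y0) =
  ux x0 y0 * vy x0 y0 - uy x0 y0 * vx x0 y0.
Proof.
have [dUx dUy _ _ _] := hU x0 y00; have [dVx dVy _ _ _] := hV x0 y00.
have eUx : derive1 (fun x => complex.Re (W (x, y0))) x0 = ux x0 y0.
  by rewrite derive1E; case: dUx.
have eUy : derive1 (fun y => complex.Re (W (x0, y))) y0 = uy x0 y0.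
  by rewrite derive1E; case: dUy.
have eVx : derive1 (fun x => complex.Im (W (x, y0))) x0 = vx x0 y0.
  by rewrite derive1E; case: dVx.
have eVy : derive1 (fun y => complex.Im (W (x0, y))) y0 = vy x0 y0.
  by rewrite derive1E; case: dVy.
rewrite /jacobian_det (expand_det_row _ ord0) !big_ord_recl big_ord0 addr0.
rewrite /cofactor !det_mx11 !mxE /= eUx eUy eVx eVy; ring.
Qed.

Hypothesis J0 : jacobian_det W (x0, y0) != 0.
Let J := jacobian_det W (x0, y0).

(* A nonzero Jacobian forces both columns of the Jacobian matrix to be nonzero,
   so W has a simple zero on the horizontal and on the vertical line. *)
Let mx := ux x0 y0 ^+ 2 + vx x0 y0 ^+ 2.
Let my := uy x0 y0 ^+ 2 + vy x0 y0 ^+ 2.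

Let mx_gt0 : 0 < mx.
Proof.
rewrite lt0r addr_ge0 ?sqr_ge0// andbT; apply: contra J0.
rewrite paddr_eq0 ?sqr_ge0// !sqrf_eq0 jacobian_detE => /andP[/eqP-> /eqP->].
by rewrite mul0r mulr0 subr0.
Qed.

Let my_gt0 : 0 < my.
Proof.
rewrite lt0r addr_ge0 ?sqr_ge0// andbT; apply: contra J0.
rewrite paddr_eq0 ?sqr_ge0// !sqrf_eq0 jacobian_detE => /andP[/eqP-> /eqP->].
by rewrite mul0r mulr0 subr0.
Qed.

Let near_horizontal : \forall t \near x0^', U t y0 ^+ 2 + V t y0 ^+ 2 != 0.
Proof.
have [dU _ _ _ _] := hU x0 y00; have [dV _ _ _ _] := hV x0 y00.
have n0 : mx != 0 by rewrite gt_eqF.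
exact: (sum_sq_neq0_near (f := U ^~ y0) (g := V ^~ y0) U0 V0 dU dV n0).
Qed.

Let near_vertical : \forall t \near y0^', 0 < t /\ U x0 t ^+ 2 + V x0 t ^+ 2 != 0.
Proof.
have [_ dU _ _ _] := hU x0 y00; have [_ dV _ _ _] := hV x0 y00.
have n0 : my != 0 by rewrite gt_eqF.
have h := sum_sq_neq0_near (f := U x0) (g := V x0) U0 V0 dU dV n0.
have h0 : \forall t \near y0^', 0 < t by apply: nbhs_dnbhs; exact: lt_nbhsr.
by apply: filterS2 h0 h.
Qed.

(* The x-derivative of the phase is followed along the vertical line, so that the
   roles of f' and g' are played by the y-derivatives: the residue is - J / my. *)
Let pole_x : rate_x x0 t * (t - y0) @[t --> y0^'] --> - J / my.
Proof.
have [_ dU _ cu _] := hU x0 y00; have [_ dV _ cv _] := hV x0 y00.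
have n0 : my != 0 by rewrite gt_eqF.
have := rotation_rate_pole U0 V0 dU dV cu cv n0.
by rewrite (_ : uy x0 y0 * vx x0 y0 - vy x0 y0 * ux x0 y0 = - J)// /J jacobian_detE; ring.
Qed.

Let pole_y : rate_y t y0 * (t - x0) @[t --> x0^'] --> J / mx.
Proof.
have [dU _ _ _ cu] := hU x0 y00; have [dV _ _ _ cv] := hV x0 y00.
have n0 : mx != 0 by rewrite gt_eqF.
have := rotation_rate_pole (f := U ^~ y0) (g := V ^~ y0) U0 V0 dU dV cu cv n0.
by rewrite (_ : ux x0 y0 * vy x0 y0 - vx x0 y0 * uy x0 y0 = J)// /J jacobian_detE; ring.
Qed.

Let near_dx_vertical : \forall t \near y0^', phase_dx W (x0, t) (rate_x x0 t).
Proof. by apply: filterS near_vertical => t [t0 n0]; exact: phase_dx_rate. Qed.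

Let near_dy_vertical : \forall t \near y0^', phase_dy W (x0, t) (rate_y x0 t).
Proof. by apply: filterS near_vertical => t [t0 n0]; exact: phase_dy_rate. Qed.

Let near_dx_horizontal : \forall t \near x0^', phase_dx W (t, y0) (rate_x t y0).
Proof. by apply: filterS near_horizontal => t n0; exact: phase_dx_rate. Qed.

Let near_dy_horizontal : \forall t \near x0^', phase_dy W (t, y0) (rate_y t y0).
Proof. by apply: filterS near_horizontal => t n0; exact: phase_dy_rate. Qed.

Let sgP : (1 = 1 :> R \/ 1 = -1 :> R). Proof. by left. Qed.
Let sgN : (-1 = 1 :> R \/ -1 = -1 :> R). Proof. by right. Qed.

Lemma phase_derivative_poles :
  [/\ exists L : \bar R, phase_lim (phase_dx W) (fun e => (x0, y0 + e)) L /\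
        ((Num.sg J)%:E * L = -oo)%E,
      exists L : \bar R, phase_lim (phase_dx W) (fun e => (x0, y0 - e)) L /\
        ((Num.sg J)%:E * L = +oo)%E,
      exists L : \bar R, phase_lim (phase_dy W) (fun e => (x0 + e, y0)) L /\
        ((Num.sg J)%:E * L = +oo)%E &
      exists L : \bar R, phase_lim (phase_dy W) (fun e => (x0 - e, y0)) L /\
        ((Num.sg J)%:E * L = -oo)%E].
Proof.
have [Jp Jn] := sg_mul_infty J0.
have mxV : 0 < mx^-1 by rewrite invr_gt0.
have myV : 0 < my^-1 by rewrite invr_gt0.
have Jx : J / mx != 0 by rewrite mulf_neq0// gt_eqF.
have Jy : - J / my != 0 by rewrite mulf_neq0 ?oppr_eq0// gt_eqF.
split.
- exists (if (0 < 1 * (- J / my))%R then +oo else -oo)%E; split.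
    apply: (phase_lim_pole (path := fun t => (x0, t)) sgP Jy _ near_dx_vertical pole_x).
    by move=> e; rewrite mul1r.
  by rewrite mul1r pmulr_lgt0.
- exists (if (0 < -1 * (- J / my))%R then +oo else -oo)%E; split.
    apply: (phase_lim_pole (path := fun t => (x0, t)) sgN Jy _ near_dx_vertical pole_x).
    by move=> e; rewrite mulN1r.
  by rewrite mulN1r mulNr opprK pmulr_lgt0.
- exists (if (0 < 1 * (J / mx))%R then +oo else -oo)%E; split.
    apply: (phase_lim_pole (path := fun t => (t, y0)) sgP Jx _ near_dy_horizontal pole_y).
    by move=> e; rewrite mul1r.
  by rewrite mul1r pmulr_lgt0.
- exists (if (0 < -1 * (J / mx))%R then +oo else -oo)%E; split.
    apply: (phase_lim_pole (path := fun t => (t, y0)) sgN Jx _ near_dy_horizontal pole_y).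
    by move=> e; rewrite mulN1r.
  by rewrite mulN1r -mulNr pmulr_lgt0.
Qed.

Lemma phase_derivative_limits (uxx uyy vxx vyy : R -> R -> R) :
  C2_on_lines ux uy uxx uyy -> C2_on_lines vx vy vxx vyy ->
  (exists l : R, phase_lim (phase_dx W) (fun e => (x0 + e, y0)) l%:E /\
     phase_lim (phase_dx W) (fun e => (x0 - e, y0)) l%:E) /\
  (exists l : R, phase_lim (phase_dy W) (fun e => (x0, y0 + e)) l%:E /\
     phase_lim (phase_dy W) (fun e => (x0, y0 - e)) l%:E).
Proof.
move=> hU2 hV2; have n1 : (1 : R) != 0 by exact: oner_neq0.
have n1' : (-1 : R) != 0 by rewrite oppr_eq0.
have [_ cuxx _ cuyy] := hU2 x0 y0 y00; have [_ cvxx _ cvyy] := hV2 x0 y0 y00.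
split.
- have lim := @rotation_rate_inflection _ (U ^~ y0) (ux ^~ y0) (uxx ^~ y0)
    (V ^~ y0) (vx ^~ y0) (vxx ^~ y0) x0 _ cuxx cvxx U0 V0 (lt0r_neq0 mx_gt0).
  eexists; split.
  + apply: (phase_lim_finite (path := fun t => (t, y0)) n1 _ near_dx_horizontal).
      by move=> e; rewrite mul1r.
    apply: lim; near=> t.
    have [? _ _ _ _] := hU t y00; have [? _ _ _ _] := hV t y00.
    by have [? _ _ _] := hU2 t y0 y00; have [? _ _ _] := hV2 t y0 y00.
  + apply: (phase_lim_finite (path := fun t => (t, y0)) n1' _ near_dx_horizontal).
      by move=> e; rewrite mulN1r.
    apply: lim; near=> t.
    have [? _ _ _ _] := hU t y00; have [? _ _ _ _] := hV t y00.
    by have [? _ _ _] := hU2 t y0 y00; have [? _ _ _] := hV2 t y0 y00.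
- have lim := @rotation_rate_inflection _ (U x0) (uy x0) (uyy x0)
    (V x0) (vy x0) (vyy x0) y0 _ cuyy cvyy U0 V0 (lt0r_neq0 my_gt0).
  eexists; split.
  + apply: (phase_lim_finite (path := fun t => (x0, t)) n1 _ near_dy_vertical).
      by move=> e; rewrite mul1r.
    apply: lim; near=> t; have t0 : 0 < t by near: t; exact: lt_nbhsr.
    have [_ ? _ _ _] := hU x0 t0; have [_ ? _ _ _] := hV x0 t0.
    by have [_ _ ? _] := hU2 x0 t t0; have [_ _ ? _] := hV2 x0 t t0.
  + apply: (phase_lim_finite (path := fun t => (x0, t)) n1' _ near_dy_vertical).
      by move=> e; rewrite mulN1r.
    apply: lim; near=> t; have t0 : 0 < t by near: t; exact: lt_nbhsr.
    have [_ ? _ _ _] := hU x0 t0; have [_ ? _ _ _] := hV x0 t0.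
    by have [_ _ ? _] := hU2 x0 t t0; have [_ _ ? _] := hV2 x0 t t0.
Unshelve. all: by end_near. Qed.

End ZeroOfWavelet.
End Main.

Theorem theorem4 (R : realType) (psi s : R -> R[i]) (x0 y0 : R)
  (hpsi : csquare_integrable psi)
  (hpsi2 : weighted_derivatives_L2 2 psi)
  (hs : csquare_integrable s)
  (hy0 : 0 < y0)
  (hW : wavelet psi s (x0, y0) = 0)
  (hJ : jacobian_det (wavelet psi s) (x0, y0) != 0) :
  let W := wavelet psi s in
  let sgJ := ((Num.sg (jacobian_det W (x0, y0)))%:E)%E in
  [/\ exists L : \bar R, phase_lim (phase_dx W) (fun e => (x0, y0 + e)) L /\
        (sgJ * L = -oo)%E,
      exists L : \bar R, phase_lim (phase_dx W) (fun e => (x0, y0 - e)) L /\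
        (sgJ * L = +oo)%E,
      exists L : \bar R, phase_lim (phase_dy W) (fun e => (x0 + e, y0)) L /\
        (sgJ * L = +oo)%E &
      exists L : \bar R, phase_lim (phase_dy W) (fun e => (x0 - e, y0)) L /\
        (sgJ * L = -oo)%E] /\
  (weighted_derivatives_L2 3 psi ->
     (exists l : R, phase_lim (phase_dx W) (fun e => (x0 + e, y0)) l%:E /\
        phase_lim (phase_dx W) (fun e => (x0 - e, y0)) l%:E) /\
     (exists l : R, phase_lim (phase_dy W) (fun e => (x0, y0 + e)) l%:E /\
        phase_lim (phase_dy W) (fun e => (x0, y0 - e)) l%:E)).
Proof.
move=> W sgJ.
have [ux [uy [vx [vy [hU hV _]]]]] := wavelet_smooth (isT : (1 < 2)%N) hpsi hs hpsi2.
split; first exact: (phase_derivative_poles hU hV hy0 hW hJ).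
move=> hpsi3.
have [ux' [uy' [vx' [vy' [hU' hV' h2]]]]] := wavelet_smooth (isT : (1 < 3)%N) hpsi hs hpsi3.
have [[uxx [uyy hU2]] [vxx [vyy hV2]]] := h2 isT.
exact: (phase_derivative_limits hU' hV' hy0 hW hJ hU2 hV2).
Qed.
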